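(* Let $u$ be a unitary element of the Cuntz algebra $\mathcal{O}_2$, and let $\lambda_u$ be the unital $*$-endomorphism of $\mathcal{O}_2$ with $\lambda_u(S_i)=uS_i$ for $i=1,2$. Suppose that $\lambda_u$ is an automorphism of $\mathcal{O}_2$ and that $\lambda_u(F)\subseteq V$. Then $u\in V$.
   Context: The Cuntz algebra $\mathcal{O}_2$ is the $C^*$-algebra generated by two isometries $S_1,S_2$ with $S_1S_1^*+S_2S_2^*=1$. For every unitary $u\in\mathcal{O}_2$ there is a unique unital $*$-endomorphism $\lambda_u$ of $\mathcal{O}_2$ with $\lambda_u(S_i)=uS_i$, $i=1,2$. $W_2$ is the set of all finite words (multi-indices, including the empty word $\emptyset$) in the alphabet $\{1,2\}$. For $\mu=\mu_1\ldots\mu_k\in W_2$ put $S_\mu=S_{\mu_1}\cdots S_{\mu_k}$, $S_\emptyset=1$, and $P_\mu=S_\mu S_\mu^*$. The Thompson groups are realized inside the unitary group of $\mathcal{O}_2$. $V$ is the group of all unitaries of $\mathcal{O}_2$ of the form $u=\sum_{(\alpha,\beta)\in\mathcal{J}}S_\alpha S_\beta^*$ with $\mathcal{J}$ a finite collection of pairs in $W_2\times W_2$; unitarity means that, with $\mathcal{J}_1=\{\alpha:(\alpha,\beta)\in\mathcal{J}\}$ and $\mathcal{J}_2=\{\beta:(\alpha,\beta)\in\mathcal{J}\}$, one has $\sum_{\alpha\in\mathcal{J}_1}P_\alpha=1=\sum_{\beta\in\mathcal{J}_2}P_\beta$. $F$ is the subgroup of those $u\in V$ for which the association $\mathcal{J}_1\ni\alpha\mapsto\beta\in\mathcal{J}_2$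 (with $(\alpha,\beta)\in\mathcal{J}$) respects the lexicographic order on $W_2$. *)

(* Defs.v *)
From HB Require Import structures.
From mathcomp Require Import all_boot all_order all_algebra.
From mathcomp Require Import finmap complex.
From mathcomp Require Import all_classical all_reals all_analysis.

Set Implicit Arguments.
Unset Strict Implicit.
Unset Printing Implicit Defensive.

Import Order.TTheory GRing.Theory Num.Theory.
Import numFieldNormedType.Exports.

Local Open Scope classical_set_scope.
Local Open Scope ring_scope.
Local Open Scope complex_scope.

(* Unital complex C*-algebras.  The multiplication is a field of the record, and
   the ring structure is declared on cstar_elt afterwards: the Hierarchy-Builder
   join of normedModType and nzRingType would have to sit below numDomainType.
   Norms over R[i] take their values in R[i], where they are nonnegative, hence
   real. *)
Record cstarAlgebra (R : realType) := CStarAlgebra {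
  banach : completeNormedModType R[i] ;
  cstar_one : banach ;
  cstar_mul : banach -> banach -> banach ;
  cstar_star : banach -> banach ;
  cstar_mulA : associative cstar_mul ;
  cstar_mul1l : left_id cstar_one cstar_mul ;
  cstar_mul1r : right_id cstar_one cstar_mul ;
  cstar_mulDl : left_distributive cstar_mul +%R ;
  cstar_mulDr : right_distributive cstar_mul +%R ;
  cstar_one_neq0 : cstar_one != 0 ;
  cstar_mulZl : forall (a : R[i]) x y,
    a *: cstar_mul x y = cstar_mul (a *: x) y ;
  cstar_mulZr : forall (a : R[i]) x y,
    a *: cstar_mul x y = cstar_mul x (a *: y) ;
  cstar_normM : forall x y, `|cstar_mul x y| <= `|x| * `|y| ;
  cstar_starK : involutive cstar_star ;
  cstar_starD : {morph cstar_star : x y / x + y} ;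
  cstar_starZ : forall (a : R[i]) x, cstar_star (a *: x) = a^* *: cstar_star x ;
  cstar_starM : forall x y,
    cstar_star (cstar_mul x y) = cstar_mul (cstar_star y) (cstar_star x) ;
  cstar_identity : forall x, `|cstar_mul (cstar_star x) x| = `|x| ^+ 2 }.

Definition cstar_elt (R : realType) (A : cstarAlgebra R) : Type := banach A.
Coercion cstar_elt : cstarAlgebra >-> Sortclass.

Section Instances.
Variables (R : realType) (A : cstarAlgebra R).

HB.instance Definition _ := CompleteNormedModule.on A.
HB.instance Definition _ := GRing.Zmodule_isNzRing.Build A (@cstar_mulA R A)
  (@cstar_mul1l R A) (@cstar_mul1r R A) (@cstar_mulDl R A) (@cstar_mulDr R A)
  (@cstar_one_neq0 R A).
HB.instance Definition _ := GRing.Lmodule_isLalgebra.Build R[i] A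
  (@cstar_mulZl R A).
HB.instance Definition _ := GRing.Lalgebra_isAlgebra.Build R[i] A
  (@cstar_mulZr R A).

Definition star : A -> A := @cstar_star R A.

End Instances.

Section Cuntz.
Context {R : realType} {A : cstarAlgebra R}.
Implicit Types (x y u : A) (B : set A) (S : 'I_2 -> A).

Definition cstar_isometry x := star x * x = 1.

Definition cstar_unitary u := star u * u = 1 /\ u * star u = 1.

Record is_cstar_subalgebra B : Prop := {
  cstar_sub_closed : closed B ;
  cstar_sub0 : B 0 ;
  cstar_subD : forall x y, B x -> B y -> B (x + y) ;
  cstar_subZ : forall (a : R[i]) x, B x -> B (a *: x) ;
  cstar_subM : forall x y, B x -> B y -> B (x * y) ;
  cstar_sub_star : forall x, B x -> B (star x) }.

(* A is the Cuntz algebra O_2 with canonical generators S.  By Cuntz's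
   uniqueness theorem these conditions determine (A, S) up to a unique
   isomorphism.  The letters 1, 2 are the elements 0, 1 of 'I_2. *)
Record is_cuntz2 S : Prop := {
  cuntz_isometry : forall i, cstar_isometry (S i) ;
  cuntz_sum : \sum_i S i * star (S i) = 1 ;
  cuntz_generated : forall B, is_cstar_subalgebra B -> (forall i, B (S i)) ->
    B = setT }.

(* seqlexi 'I_2 is seq 'I_2 carrying the lexicographic order. *)
Definition word2 := seqlexi 'I_2.

Definition cuntz_word S (mu : word2) : A := \prod_(i <- mu) S i.

(* When such a sum is unitary, the words p.1 (p in J) are pairwise distinct and
   their range projections add up to 1, and likewise the words p.2: in the canonical
   representation on l^2({1,2}^N) the sum is a unitary matrix with entries in
   nat, hence a permutation matrix. *)
Definition thompson_repr S (J : {fset word2 * word2}) u : Prop :=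
  cstar_unitary u /\
  u = \sum_(p <- J) cuntz_word S p.1 * star (cuntz_word S p.2).

Definition thompsonV S : set A := [set u | exists J, thompson_repr S J u].

(* Two pairs with equal first components must have equal second components, by
   antisymmetry: this includes that p.1 determines p.2. *)
Definition lexi_monotone (J : {fset word2 * word2}) : Prop :=
  forall p q, p \in J -> q \in J -> (p.1 <= q.1)%O -> (p.2 <= q.2)%O.

Definition thompsonF S : set A :=
  [set u | exists2 J, thompson_repr S J u & lexi_monotone J].

End Cuntz.

(* Main.v *)
Require Import Defs.
From mathcomp Require Import all_boot all_order all_algebra.
From mathcomp Require Import finmap complex.
From mathcomp Require Import all_classical all_reals all_analysis.
From mathcomp Require Import lra zify.

Set Implicit Arguments.
Unset Strict Implicit.
Unset Printing Implicit Defensive.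

Import Order.TTheory GRing.Theory Num.Theory.
Import numFieldNormedType.Exports.

Local Open Scope classical_set_scope.
Local Open Scope ring_scope.
Local Open Scope complex_scope.

(** Think of an element b of O_2 as an infinite matrix, indexed by the points of the
    Cantor set of infinite words, in the canonical representation S_i d_x = d_(ix).
    Elements of V are permutation matrices.  The proof reads off the entries of u and
    shows that they are 0 or 1, which is enough to put u in V.

    Entries without a representation.  Let z be an infinite word that is not eventually
    periodic, and let z_m be its prefix of length m.  For a finite linear combination a
    of the S_p S_q^*, the element S_(w z_m)^* a S_(w' z_m) is for m large a scalar, the
    entry of a at the points wz and w'z, and such combinations are norm dense.  So the
    limit of S_(w z_m)^* b S_(w' z_m) plays the part of that entry for every b.
    An element whose entries all vanish is 0 ([entry0_eq0]).  This replaces the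
    simplicity of O_2: with T a sum of n consecutive iterates of the canonical
    endomorphism applied to S_(z_m), the map b |-> T^* b T / n is contractive, depends on
    the entries of b only up to a small error, and converges to the identity as n grows.
    The approximation by combinations also gives [zero_one_sum]: if all the entries of b
    are 0 or 1, then b is a finite sum of distinct S_p S_q^*.

    Images of cylinder projections.  Write lambda for lambda_u.  Let x_0 be the standard
    generator of F, under which every point of the Cantor set other than its two ends
    drifts towards 00..., and let f in F be the copy of x_0 inside the cylinder of d.
    If f^n b = b with n > 0, then P_d b = 0 ([copy_at_fix_eq0]).  Put v = lambda(f), an
    element of V, and q = lambda(P_d), so that v (1 - q) = 1 - q.  A point y that is not
    eventually periodic has one of two fates ([lam_cylinder_entry]).  If v^n y = y with
    n > 0, then v^n is the identity on a cylinder C around y, because the germs of V are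
    of the form p t |-> r t; so lambda^-1(C) is fixed by f^n and q C = 0.  Otherwise the
    orbit of y is infinite; the entries of 1 - q in row y are constant along it, and they
    are arbitrarily small far along the orbit since 1 - q is a limit of matrices with
    finitely many nonzero entries in each column ([entry_wandering]), so that row is 0.
    Hence q is diagonal with entries 0 and 1, and it is a finite sum of cylinder
    projections ([lam_cylinder]).

    Back to u.  Let t be a word i...ij with j the letter other than i.  The partial
    isometry S_i' P_t is the product of P_t with a word in F, for either letter i', so
    lambda(S_i' P_t) = u S_i' lambda(P_t) is a finite sum of S_p S_q^* ([lam_gen_run]).
    The projections lambda(P_t) together meet every cylinder, because an element killed
    by all the P_t has zero entries ([lam_run_meets]).  So every cylinder contains points
    at which the column of u consists of natural numbers, that is of 0 and 1 as u has
    norm 1 ([zero_one_u]), and [zero_one_sum] concludes. *)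

(** * Norm and involution *)
Section CstarNorm.
Context {R : realType} {A : cstarAlgebra R}.
Implicit Types (x y : A) (a : R[i]).

Lemma starK : involutive (@star R A). Proof. exact: cstar_starK. Qed.
Lemma starD : {morph (@star R A) : x y / x + y}. Proof. exact: cstar_starD. Qed.
Lemma starZ a x : star (a *: x) = a^* *: star x. Proof. exact: cstar_starZ. Qed.
Lemma starM x y : star (x * y) = star y * star x. Proof. exact: cstar_starM. Qed.

Lemma star0 : star (0 : A) = 0.
Proof. by apply: (@addrI _ (star 0)); rewrite -starD !addr0. Qed.

Lemma starN x : star (- x) = - star x.
Proof. by apply: (@addrI _ (star x)); rewrite -starD !subrr star0. Qed.

Lemma starB x y : star (x - y) = star x - star y.
Proof. by rewrite starD starN. Qed.

Lemma star1 : star (1 : A) = 1.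
Proof. by rewrite -[LHS]mulr1 -{2}(starK 1) -starM mulr1 starK. Qed.

Lemma star_sum (I : Type) (s : seq I) (P : pred I) (f : I -> A) :
  star (\sum_(i <- s | P i) f i) = \sum_(i <- s | P i) star (f i).
Proof. exact: (big_morph _ starD star0). Qed.

(** The norm of a normed space over R[i] is itself an element of R[i]; its real part,
    which carries all of it, lives where real arithmetic applies. *)
Definition nrm x : R := complex.Re `|x|.

Lemma normE x : `|x| = (nrm x)%:C.
Proof. by rewrite /nrm (RRe_real (normr_real x)). Qed.

Lemma nrm_ge0 x : 0 <= nrm x.
Proof. by rewrite -ler0c -normE. Qed.

Lemma nrm0 : nrm 0 = 0. Proof. by rewrite /nrm normr0. Qed.

Lemma nrm0_eq x : nrm x = 0 -> x = 0.
Proof. by move=> h; apply/eqP; rewrite -normr_eq0 normE h. Qed.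

Lemma ler_nrmD x y : nrm (x + y) <= nrm x + nrm y.
Proof. by rewrite -lecR rmorphD /= -!normE ler_normD. Qed.

Lemma nrmN x : nrm (- x) = nrm x.
Proof. by rewrite /nrm normrN. Qed.

Lemma ler_nrmB x y : nrm (x - y) <= nrm x + nrm y.
Proof. by rewrite -(nrmN y) ler_nrmD. Qed.

Lemma ler_nrmM x y : nrm (x * y) <= nrm x * nrm y.
Proof. rewrite -lecR rmorphM /= -!normE; exact: cstar_normM. Qed.

Lemma nrm_sqr x : nrm (star x * x) = nrm x ^+ 2.
Proof.
apply: (@complexI R); rewrite rmorphXn /= -!normE; exact: cstar_identity.
Qed.

Lemma nrm1 : nrm 1 = 1.
Proof.
have n0 : nrm 1 != 0.
  by apply/eqP => /nrm0_eq h; have := oner_neq0 A; rewrite h eqxx.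
by apply: (mulfI n0); rewrite mulr1 -expr2 -nrm_sqr star1 mulr1.
Qed.

Lemma nrmZ a x : nrm (a *: x) = nrm (a%:A) * nrm x.
Proof.
apply: (@complexI R); rewrite rmorphM /= -!normE !normrZ.
by rewrite (normE 1) nrm1 mulr1.
Qed.

Lemma nrmZnat (n : nat) x : nrm (n%:R *: x) = n%:R * nrm x.
Proof.
apply: (@complexI R); rewrite rmorphM /= -!normE !normrZ normr_nat.
by rewrite rmorph_nat.
Qed.

Lemma nrm_star x : nrm (star x) = nrm x.
Proof.
have le y : nrm y <= nrm (star y).
  have [->|y0] := eqVneq (nrm y) 0; first exact: nrm_ge0.
  have yp : 0 < nrm y by rewrite lt_def y0 nrm_ge0.
  by rewrite -(ler_pM2r yp) -expr2 -nrm_sqr ler_nrmM.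
by apply/eqP; rewrite eq_le le andbT; have := le (star x); rewrite starK.
Qed.

Lemma ler_nrm_sum (I : Type) (s : seq I) (P : pred I) (f : I -> A) :
  nrm (\sum_(i <- s | P i) f i) <= \sum_(i <- s | P i) nrm (f i).
Proof.
elim/big_rec2: _ => [|i y x _ h]; first by rewrite nrm0.
by apply: le_trans (ler_nrmD _ _) _; rewrite lerD2l.
Qed.

Lemma nrm_isometry x : cstar_isometry x -> nrm x = 1.
Proof.
move=> h; apply/eqP; rewrite -(@pexpr_eq1 _ _ 2) ?nrm_ge0 //.
by rewrite -nrm_sqr h nrm1.
Qed.

Lemma nrm_le1M x y : nrm x <= 1 -> nrm y <= 1 -> nrm (x * y) <= 1.
Proof.
by move=> hx hy; apply: le_trans (ler_nrmM _ _) _; rewrite mulr_ile1 ?nrm_ge0.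
Qed.

Lemma nrm_compress x y b : nrm x <= 1 -> nrm y <= 1 ->
  nrm (star x * b * y) <= nrm b.
Proof.
move=> hx hy; apply: le_trans (ler_nrmM _ _) _.
apply: (@le_trans _ _ (nrm (star x * b))); first by rewrite ler_piMr ?nrm_ge0.
by apply: le_trans (ler_nrmM _ _) _; rewrite ler_piMl ?nrm_star ?nrm_ge0.
Qed.

Lemma nrm_small x : (forall e, 0 < e -> nrm x <= e) -> x = 0.
Proof.
move=> h; apply: nrm0_eq; apply/eqP; rewrite eq_le nrm_ge0 andbT.
by apply/ler_addgt0Pr => e e0; rewrite add0r h.
Qed.

End CstarNorm.

(** * Infinite words *)
Section Streams.
Implicit Types (z : nat -> 'I_2) (w : seq 'I_2).

Definition stail (i : nat) z : nat -> 'I_2 := fun n => z (i + n)%N.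
Definition pre z m : seq 'I_2 := mkseq z m.
Definition scat w z : nat -> 'I_2 :=
  fun n => if (n < size w)%N then nth ord0 w n else z (n - size w)%N.

(** Words that are not eventually periodic.  They are the points at which two different
    monomials w z and w' z never coincide, which keeps matrix entries from adding up. *)
Definition aperiodic z := forall i j, stail i z = stail j z -> i = j.

Lemma size_pre z m : size (pre z m) = m. Proof. exact: size_mkseq. Qed.

Lemma pre_cat z i m : pre z (i + m) = pre z i ++ pre (stail i z) m.
Proof.
rewrite /pre /mkseq iotaD map_cat add0n; congr (_ ++ _).
by rewrite -[in LHS](addn0 i) iotaDl -map_comp.
Qed.

Lemma nth_scat w z m n : (n < size w + m)%N ->
  nth ord0 (w ++ pre z m) n = scat w z n.
Proof.
move=> hn; rewrite nth_cat /scat; case: ltnP => // hw.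
by rewrite nth_mkseq // ltn_subLR.
Qed.

Lemma pre_scat w z m : pre (scat w z) (size w + m) = w ++ pre z m.
Proof.
apply: (@eq_from_nth _ ord0); first by rewrite size_cat !size_pre.
by move=> i; rewrite size_pre => hi; rewrite nth_scat // nth_mkseq.
Qed.

Lemma stail_stail i j z : stail i (stail j z) = stail (j + i) z.
Proof. by apply/funext => n; rewrite /stail addnA. Qed.

Lemma aperiodic_stail i z : aperiodic z -> aperiodic (stail i z).
Proof. by move=> az j k; rewrite !stail_stail => /az /addnI. Qed.

Lemma scat_pre j z : scat (pre z j) (stail j z) = z.
Proof.
apply/funext => n; rewrite /scat size_pre; case: ltnP => h.
  by rewrite nth_mkseq.
by rewrite /stail subnKC.
Qed.

Lemma stail_scat w z : stail (size w) (scat w z) = z.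
Proof. by apply/funext => n; rewrite /stail /scat ltnNge leq_addr addKn. Qed.

Lemma aperiodic_scat w z : aperiodic z -> aperiodic (scat w z).
Proof.
move=> az i j /(congr1 (stail (size w))).
have sh k : stail (size w) (stail k (scat w z)) = stail k z.
  by rewrite stail_stail addnC -stail_stail stail_scat.
by rewrite !sh => /az.
Qed.

Lemma scat_inj z w w' : aperiodic z -> scat w z = scat w' z -> w = w'.
Proof.
move=> az e.
have hs : size w = size w'.
  have := congr1 (stail (size w + size w')) e.
  rewrite -stail_stail stail_scat addnC -stail_stail stail_scat.
  by move/az.
apply: (@eq_from_nth _ ord0) => // i hi.
by have := congr1 (@^~ i) e; rewrite /scat -hs hi.
Qed.

Definition pow2_stream : nat -> 'I_2 :=
  fun n => if n == (2 ^ trunc_log 2 n)%N then ord_max else ord0.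

(** A shift of a high power of two by less than itself is not a power of two, so no
    period can survive beyond it. *)
Lemma pow2_stream_aperiodic : aperiodic pow2_stream.
Proof.
suff lt_stail i j : (i < j)%N -> stail i pow2_stream <> stail j pow2_stream.
  by move=> i j e; case: (ltngtP i j) => // /lt_stail; rewrite e.
move=> ij e.
have lt_j : (j < 2 ^ j)%N by exact: ltn_expl.
have := congr1 (@^~ (2 ^ j - i)%N) e; rewrite /stail /pow2_stream.
have -> : (i + (2 ^ j - i) = 2 ^ j)%N by lia.
rewrite trunc_expnK // eqxx.
have -> : (trunc_log 2 (j + (2 ^ j - i)) = j)%N.
  by apply: trunc_log_eq => //; rewrite expnS; lia.
by case: eqP => //; lia.
Qed.

End Streams.

(** * Words in the generators *)
Section Words.
Context {R : realType} {A : cstarAlgebra R} (S : 'I_2 -> A).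
Context (cuntzS : is_cuntz2 S).
Implicit Types (x y : A) (a : R[i]) (w t d : seq 'I_2).

Local Notation W := (cuntz_word S).

Lemma word_nil : W [::] = 1. Proof. exact: big_nil. Qed.
Lemma word_cons i w : W (i :: w) = S i * W w. Proof. exact: big_cons. Qed.
Lemma word_cat w t : W (w ++ t) = W w * W t. Proof. exact: big_cat. Qed.
Lemma word1 i : W [:: i] = S i. Proof. exact: big_seq1. Qed.

(** The ranges of S_0 and S_1 are orthogonal since their projections add up to 1:
    compressing that sum by S_i leaves S_i^* S_j S_j^* S_i = 0, the square of a norm. *)
Lemma star_gen i j : star (S i) * S j = (i == j)%:R.
Proof.
have [->|ij] := eqVneq i j; first exact: (cuntz_isometry cuntzS).
have h0 : star (S i) * (S j * star (S j)) * S i = 0.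
  have := congr1 (fun x => star (S i) * x * S i) (cuntz_sum cuntzS).
  rewrite mulr1 (cuntz_isometry cuntzS) (bigD1 i) //= (bigD1 j) 1?eq_sym //=.
  rewrite big_pred0 => [|k]; last first.
    by apply/negP => /andP[ki kj]; move: ij ki kj; case: i => -[|[]] // ?;
       case: j => -[|[]] // ?; case: k => -[|[]].
  rewrite addr0 mulrDr mulrDl mulrA (cuntz_isometry cuntzS) mul1r.
  by rewrite (cuntz_isometry cuntzS) -[RHS]addr0 => /addrI.
apply: nrm0_eq; apply/eqP; rewrite -nrm_star -sqrf_eq0 -nrm_sqr.
by rewrite starK starM starK !mulrA in h0 *; rewrite h0 nrm0.
Qed.

Lemma star_word_word d w : (size d <= size w)%N ->
  star (W d) * W w = if take (size d) w == d then W (drop (size d) w) else 0.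
Proof.
elim: d w => [|i d IH] [|j w] //= hs; rewrite ?word_nil ?star1 ?mul1r ?word_nil //.
rewrite !word_cons starM mulrA -(mulrA (star (W d))) star_gen eqseq_cons.
by have [_|ne] := eqVneq i j; rewrite ?mulr0 ?mul0r // mulr1 IH.
Qed.

Lemma star_wordK w : star (W w) * W w = 1.
Proof. by rewrite star_word_word // take_size eqxx drop_size word_nil. Qed.

Lemma nrm_word w : nrm (W w) = 1.
Proof. exact/nrm_isometry/star_wordK. Qed.

Lemma word_neq0 w : W w != 0.
Proof.
by apply/eqP => h; have := nrm_word w; rewrite h nrm0 => /esym/eqP; rewrite oner_eq0.
Qed.

Lemma star_word_orth w w' n : (n < size w)%N -> (n < size w')%N ->
  nth ord0 w n != nth ord0 w' n -> star (W w) * W w' = 0.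
Proof.
elim: n w w' => [|n IH] [|i w] [|j w'] //= hw hw' hn;
  rewrite !word_cons starM mulrA -(mulrA (star (W w))) star_gen.
  by rewrite (negPf hn) mulr0 mul0r.
by case: eqP => _; rewrite ?mulr0 ?mul0r // mulr1 IH.
Qed.

(** A cylinder is the union of its subcylinders of depth n. *)
Lemma eq_mul_word_cat x y w n :
  (forall t, size t = n -> x * W (w ++ t) = y * W (w ++ t)) ->
  x * W w = y * W w.
Proof.
elim: n w => [|n IH] w h; first by have := h [::] erefl; rewrite cats0.
have e i : x * W (w ++ [:: i]) = y * W (w ++ [:: i]).
  by apply: IH => t ht; rewrite -catA; apply: h; rewrite /= ht.
have split u : u * W w =
    \sum_i u * W (w ++ [:: i]) * star (S i).
  rewrite -[in LHS](mulr1 (W w)) -(cuntz_sum cuntzS) !mulr_sumr.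
  by apply: eq_bigr => i _; rewrite word_cat word1 !mulrA.
by rewrite !split; apply: eq_bigr => i _; rewrite e.
Qed.

Lemma star_word_scat w z w' z' : scat w z <> scat w' z' ->
  exists m0, forall m m', (m0 <= m)%N -> (m0 <= m')%N ->
    star (W (w ++ pre z m)) * W (w' ++ pre z' m') = 0.
Proof.
move=> ne; have [n hn] : exists n, scat w z n <> scat w' z' n.
  by apply: contrapT => h; apply: ne; apply/funext => n; apply: contrapT => hn;
     apply: h; exists n.
exists n.+1 => m m' hm hm'; apply: (@star_word_orth _ _ n).
- by rewrite size_cat size_pre; lia.
- by rewrite size_cat size_pre; lia.
- by rewrite !nth_scat; [exact/eqP | lia | lia].
Qed.

(** Along the prefixes of an aperiodic z the words w z behave like orthonormal vectors:
    w z and w' z differ at some index, and the prefixes become orthogonal there. *)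
Lemma star_word_aperiodic z w w' : aperiodic z ->
  \forall m \near \oo,
    star (W (w ++ pre z m)) * W (w' ++ pre z m) = (w == w')%:R.
Proof.
move=> az; have [<-|ne] := eqVneq w w'.
  by near=> m; rewrite star_wordK.
have [m0 h] : exists m0, forall m m', (m0 <= m)%N -> (m0 <= m')%N ->
    star (W (w ++ pre z m)) * W (w' ++ pre z m') = 0.
  by apply: star_word_scat => /(scat_inj az)/eqP; exact/negP.
by exists m0 => // m /= hm; exact: h.
Unshelve. all: by end_near. Qed.

End Words.

(** * Monomials and matrix entries *)
Section Entries.
Context {R : realType} {A : cstarAlgebra R} (S : 'I_2 -> A).
Context (cuntzS : is_cuntz2 S).
Implicit Types (x y b : A) (a : R[i]) (w t d : seq 'I_2) (z : nat -> 'I_2).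

Local Notation W := (cuntz_word S).
Local Notation words := (seq 'I_2).

Definition mono (p : words * words) : A := W p.1 * star (W p.2).
Definition lincomb (s : seq (R[i] * (words * words))) : A :=
  \sum_(q <- s) q.1 *: mono q.2.

(** Sums of monomials with repetition allowed: a star-closed semiring containing V, so
    that products of elements of V and of cylinder projections stay in it. *)
Definition nat_span b := exists s : seq (words * words), b = \sum_(p <- s) mono p.

Lemma star_mono p : star (mono p) = mono (p.2, p.1).
Proof. by rewrite /mono starM starK. Qed.

Lemma mono_word w : mono (w, [::]) = W w.
Proof. by rewrite /mono /= word_nil star1 mulr1. Qed.

Lemma monoM p q : mono p * mono q = 0 \/ exists r, mono p * mono q = mono r.
Proof.
case: p q => [p1 p2] [q1 q2]; rewrite /mono /= !mulrA -(mulrA (W p1)).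
case: (leqP (size p2) (size q1)) => [h|/ltnW h].
  rewrite (star_word_word cuntzS h); case: eqP => _; last by left; rewrite mulr0 mul0r.
  by right; exists (p1 ++ drop (size p2) q1, q2); rewrite /= word_cat.
have -> : star (W p2) * W q1 = star (star (W q1) * W p2) by rewrite starM starK.
rewrite (star_word_word cuntzS h); case: eqP => _.
  by right; exists (p1, q2 ++ drop (size q1) p2); rewrite /= word_cat starM mulrA.
by left; rewrite star0 mulr0 mul0r.
Qed.

Lemma nat_span0 : nat_span 0. Proof. by exists [::]; rewrite big_nil. Qed.

Lemma nat_span_mono p : nat_span (mono p).
Proof. by exists [:: p]; rewrite big_seq1. Qed.

Lemma nat_span_word w : nat_span (W w).
Proof. by rewrite -mono_word; exact: nat_span_mono. Qed.

Lemma nat_span1 : nat_span 1.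
Proof. by rewrite -(word_nil S); exact: nat_span_word. Qed.

Lemma nat_spanD x y : nat_span x -> nat_span y -> nat_span (x + y).
Proof. by move=> [s ->] [s' ->]; exists (s ++ s'); rewrite big_cat. Qed.

Lemma nat_span_sum (I : Type) (s : seq I) (f : I -> A) :
  (forall i, nat_span (f i)) -> nat_span (\sum_(i <- s) f i).
Proof.
move=> h; elim: s => [|i s IH]; first by rewrite big_nil; exact: nat_span0.
by rewrite big_cons; exact: nat_spanD.
Qed.

Lemma nat_spanM x y : nat_span x -> nat_span y -> nat_span (x * y).
Proof.
move=> [s ->] [s' ->]; rewrite mulr_suml; apply: nat_span_sum => p.
rewrite mulr_sumr; apply: nat_span_sum => q.
by case: (monoM p q) => [->|[r ->]]; [exact: nat_span0 | exact: nat_span_mono].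
Qed.

Lemma nat_spanX x n : nat_span x -> nat_span (x ^+ n).
Proof.
by move=> h; elim: n => [|n IH]; [exact: nat_span1 | rewrite exprS; exact: nat_spanM].
Qed.

Lemma nat_span_star x : nat_span x -> nat_span (star x).
Proof.
move=> [s ->]; rewrite star_sum; apply: nat_span_sum => p.
by rewrite star_mono; exact: nat_span_mono.
Qed.

Lemma lincomb_cat s s' : lincomb (s ++ s') = lincomb s + lincomb s'.
Proof. exact: big_cat. Qed.

Lemma lincombZ a s : exists s', a *: lincomb s = lincomb s'.
Proof.
exists [seq (a * q.1, q.2) | q <- s]; rewrite /lincomb scaler_sumr big_map.
by apply: eq_bigr => q _; rewrite scalerA.
Qed.

Lemma lincomb_sum (I : Type) (r : seq I) (f : I -> A) :
  (forall i, exists s, f i = lincomb s) -> exists s, \sum_(i <- r) f i = lincomb s.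
Proof.
move=> h; elim: r => [|i r [s IH]]; first by exists [::]; rewrite /lincomb !big_nil.
by have [s' hs'] := h i; exists (s' ++ s); rewrite big_cons IH hs' lincomb_cat.
Qed.

Lemma lincombM s s' : exists s'', lincomb s * lincomb s' = lincomb s''.
Proof.
rewrite /lincomb mulr_suml; apply: lincomb_sum => p.
rewrite mulr_sumr; apply: lincomb_sum => q.
rewrite -scalerAl -scalerAr scalerA; case: (monoM p.2 q.2) => [->|[r ->]].
  by exists [::]; rewrite scaler0 /lincomb big_nil.
by exists [:: (p.1 * q.1, r)]; rewrite /lincomb big_seq1.
Qed.

Lemma lincomb_star s : exists s', star (lincomb s) = lincomb s'.
Proof.
rewrite /lincomb star_sum; apply: lincomb_sum => q.
by exists [:: (q.1^*, (q.2.2, q.2.1))]; rewrite starZ star_mono /lincomb big_seq1.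
Qed.

(** The closure of the combinations of monomials is a C*-subalgebra, so it is everything
    by the generation hypothesis on O_2. *)
Lemma lincomb_dense b (e : R) : 0 < e -> exists s, nrm (b - lincomb s) < e.
Proof.
pose B := [set x : A | forall e : R, 0 < e -> exists s, nrm (x - lincomb s) < e].
have lin s : B (lincomb s).
  by move=> d d0; exists s; rewrite subrr nrm0.
have bnd x (d : R) : B x -> 0 < d ->
    exists2 s, nrm (x - lincomb s) < d & nrm (lincomb s) < nrm x + d.
  move=> Bx d0; have [s hs] := Bx d d0; exists s => //.
  rewrite -[lincomb s](subKr x); apply: le_lt_trans (ler_nrmB _ _) _.
  by rewrite ltrD2l.
suff BT : B = setT by move=> e0; have Bb : B b; [by rewrite BT | exact: Bb].
apply: (cuntz_generated cuntzS) => [|i]; last first.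
  suff -> : S i = lincomb [:: (1, ([:: i], [::]))] by exact: lin.
  by rewrite /lincomb big_seq1 scale1r /= mono_word word1.
split.
- move=> x clx d d0.
  have [|y [By xy]] := clx [set y | nrm (x - y) < d / 2].
    apply/nbhs_ballP; exists (d / 2)%:C => /=.
      by rewrite ltcR divr_gt0.
    by move=> y; rewrite -ball_normE /= normE ltcR.
  have [s hs] := By _ (divr_gt0 d0 (ltr0n _ 2)); exists s.
  rewrite -(subrK y x) -addrA; apply: le_lt_trans (ler_nrmD _ _) _.
  by rewrite [d]splitr ltrD.
- by have := lin [::]; rewrite /lincomb big_nil.
- move=> x y Bx By d d0; have d2 : 0 < d / 2 by rewrite divr_gt0.
  have [[s hs] [s' hs']] := (Bx _ d2, By _ d2); exists (s ++ s').
  rewrite lincomb_cat opprD addrACA; apply: le_lt_trans (ler_nrmD _ _) _.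
  by rewrite [d]splitr ltrD.
- move=> a x Bx d d0; have k0 : 0 < nrm (a%:A : A) + 1.
    by rewrite ltr_wpDl ?nrm_ge0.
  have [s hs] := Bx _ (divr_gt0 d0 k0).
  have [s' e'] := lincombZ a s; exists s'; rewrite -e' -scalerBr nrmZ.
  apply: (@le_lt_trans _ _ ((nrm (a%:A : A) + 1) * nrm (x - lincomb s))).
    by rewrite ler_wpM2r ?nrm_ge0 // lerDl.
  by rewrite mulrC -ltr_pdivlMr.
- move=> x y Bx By d d0.
  pose k := nrm x + nrm y + 1.
  have k0 : 0 < k by rewrite ltr_wpDl ?addr_ge0 ?nrm_ge0.
  (* c <= 1 keeps the norm of the approximant of x below nrm x + 1, and the other
     bound makes the two error terms c * nrm y and (nrm x + 1) * c add up to less than d. *)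
  pose c := Num.min 1 (d / (2 * k)).
  have dk0 : 0 < d / (2 * k) by rewrite divr_gt0 // mulr_gt0.
  have c0 : 0 < c by rewrite lt_min ltr01.
  have [[s hs bs] [s' hs' _]] := (bnd _ _ Bx c0, bnd _ _ By c0).
  have [s'' e''] := lincombM s s'; exists s''; rewrite -e''.
  have -> : x * y - lincomb s * lincomb s' =
      (x - lincomb s) * y + lincomb s * (y - lincomb s').
    by rewrite mulrBl mulrBr addrA subrK.
  apply: le_lt_trans (ler_nrmD _ _) _.
  have c1 : c <= 1 by rewrite ge_min lexx.
  have ck : c * (2 * k) <= d.
    by rewrite -ler_pdivlMr ?mulr_gt0 // ge_min lexx orbT.
  have h1 : nrm ((x - lincomb s) * y) <= c * nrm y.
    by apply: le_trans (ler_nrmM _ _) _; rewrite ler_wpM2r ?nrm_ge0 // ltW.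
  have h2 : nrm (lincomb s * (y - lincomb s')) <= (nrm x + 1) * c.
    apply: le_trans (ler_nrmM _ _) _; rewrite ler_pM ?nrm_ge0 ?(ltW hs') //.
    by apply: le_trans (ltW bs) _; rewrite lerD2l.
  apply: le_lt_trans (lerD h1 h2) _; move: ck; rewrite /k.
  by have := nrm_ge0 x; have := nrm_ge0 y; nra.
- move=> x Bx d d0; have [s hs] := Bx d d0; have [s' e'] := lincomb_star s.
  by exists s'; rewrite -e' -starB nrm_star.
Qed.

(** N bounds the number of letters that the monomials of s may remove from an infinite
    word; beyond that depth the combination acts letter by letter as the identity. *)
Definition short (N : nat) (s : seq (R[i] * (words * words))) :=
  forall q, q \in s -> (size q.2.2 <= N)%N.

Lemma lincomb_short s : exists N, short N s.
Proof.
exists (\sum_(q <- s) size q.2.2)%N => q qs.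
by rewrite (big_rem q) //= leq_addr.
Qed.

Lemma short_approx b (e : R) : 0 < e ->
  exists s N, nrm (b - lincomb s) < e /\ short N s.
Proof.
move=> /(lincomb_dense b)[s hs]; have [N hN] := lincomb_short s.
by exists s, N.
Qed.

(** In the canonical representation these compressions converge to the matrix entry of b
    at the points wz (row) and w'z (column). *)
Definition corner b w w' z m : A :=
  star (W (w ++ pre z m)) * b * W (w' ++ pre z m).

Definition entry b w w' z a := forall e : R, 0 < e ->
  \forall m \near \oo, nrm (corner b w w' z m - a%:A) < e.

Lemma cornerB b b' w w' z m :
  corner (b - b') w w' z m = corner b w w' z m - corner b' w w' z m.
Proof. by rewrite /corner mulrBr mulrBl. Qed.

Lemma nrm_corner b w w' z m : nrm (corner b w w' z m) <= nrm b.
Proof. by apply: nrm_compress; rewrite nrm_word. Qed.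

Lemma entry_exact b w w' z a :
  (\forall m \near \oo, corner b w w' z m = a%:A) -> entry b w w' z a.
Proof.
move=> h e e0; near=> m; rewrite (_ : corner _ _ _ _ _ = a%:A) ?subrr ?nrm0 //.
by near: m.
Unshelve. all: by end_near. Qed.

Lemma entryB b b' w w' z a a' : entry b w w' z a -> entry b' w w' z a' ->
  entry (b - b') w w' z (a - a').
Proof.
move=> h h' e e0; have e2 : 0 < e / 2 by rewrite divr_gt0.
near=> m.
have -> : corner (b - b') w w' z m - (a - a')%:A =
    (corner b w w' z m - a%:A) - (corner b' w w' z m - a'%:A).
  by rewrite cornerB scalerBl !opprD !opprK addrACA.
apply: le_lt_trans (ler_nrmB _ _) _.
by rewrite [e]splitr ltrD //; near: m; [exact: h | exact: h'].
Unshelve. all: by end_near. Qed.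

Lemma corner_scat b w w' t z m :
  corner b w w' (scat t z) (size t + m)%N = corner b (w ++ t) (w' ++ t) z m.
Proof. by rewrite /corner pre_scat !catA. Qed.

Lemma near_addl k (P : nat -> Prop) :
  (\forall m \near \oo, P (k + m)%N) <-> (\forall m \near \oo, P m).
Proof.
split=> -[N _ h].
  exists (k + N)%N => // m /= hm; have -> : m = (k + (m - k))%N by lia.
  by apply: h => /=; lia.
by exists N => // m /= hm; apply: h => /=; lia.
Qed.

(** Both sides speak of the same pair of points, written with two different common
    tails. *)
Lemma entry_scat b w w' t z a :
  entry b w w' (scat t z) a <-> entry b (w ++ t) (w' ++ t) z a.
Proof.
split=> h e e0.
  have /(iffRL (near_addl (size t) _)) := h e e0.
  by apply: filterS => m; rewrite corner_scat.
apply/(near_addl (size t)); apply: filterS (h e e0) => m.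
by rewrite corner_scat.
Qed.

Lemma entry_dist b w w' z a x (e : R) : entry b w w' z a -> 0 < e ->
  (\forall m \near \oo, nrm (corner b w w' z m - x) < e) ->
  nrm (a%:A - x) < e + e.
Proof.
move=> h e0 h'; have [m [h1 h2]] : exists m,
    nrm (corner b w w' z m - a%:A) < e /\ nrm (corner b w w' z m - x) < e.
  have : \forall m \near \oo, nrm (corner b w w' z m - a%:A) < e /\
           nrm (corner b w w' z m - x) < e.
    by near=> m; split; near: m => //; exact: h.
  by case=> N _ hN; exists N; apply: hN => /=.
have -> : a%:A - x =
    (corner b w w' z m - x) - (corner b w w' z m - a%:A).
  by rewrite opprB [RHS]addrC addrA subrK.
by apply: le_lt_trans (ler_nrmB _ _) _; rewrite ltrD.
Unshelve. all: by end_near. Qed.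

Lemma entry_uniq b w w' z a a' :
  entry b w w' z a -> entry b w w' z a' -> a = a'.
Proof.
move=> h h'; apply/eqP; rewrite -subr_eq0; apply/eqP.
have : (a - a')%:A = 0 :> A.
  apply: nrm_small => e e0; rewrite scalerBl ltW // [e]splitr.
  by apply: (entry_dist h); [rewrite divr_gt0 | apply: h'; rewrite divr_gt0].
by move/eqP; rewrite scaler_eq0 oner_eq0 orbF => /eqP.
Qed.

(** The entry of the monomial p at the points wz and w'z, for any z: whether p replaces
    its second word by its first one so as to turn w' into w. *)
Definition mono_coef (p : words * words) w w' : bool :=
  (take (size p.2) w' == p.2) && (w == p.1 ++ drop (size p.2) w').

Definition coef (s : seq (R[i] * (words * words))) w w' : R[i] :=
  \sum_(q <- s) q.1 * (mono_coef q.2 w w')%:R.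

Lemma corner_mono p w w' z : (size p.2 <= size w')%N -> aperiodic z ->
  \forall m \near \oo, corner (mono p) w w' z m = (mono_coef p w w')%:R.
Proof.
move=> hp az; rewrite /mono_coef; case: eqP => [e|ne] /=; last first.
  near=> m; rewrite /corner /mono (word_cat S w') -!mulrA.
  rewrite (mulrA (star (W p.2)) (W w')) (star_word_word cuntzS hp).
  by case: eqP => // _; rewrite mul0r !mulr0.
near=> m; rewrite /corner /mono (word_cat S w') -!mulrA.
rewrite (mulrA (star (W p.2)) (W w')) (star_word_word cuntzS hp) e eqxx.
rewrite (mulrA (W p.1)) -!word_cat.
by near: m; exact: (star_word_aperiodic cuntzS).
Unshelve. all: by end_near. Qed.

(** The limit is reached at a finite stage and does not depend on z once w' is deep
    enough.  This local constancy is what lets one column control a whole cylinder. *)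
Lemma corner_lincomb s N w w' z : short N s -> (N <= size w')%N -> aperiodic z ->
  \forall m \near \oo, corner (lincomb s) w w' z m = (coef s w w')%:A.
Proof.
move=> hs hN az; elim: s hs => [|q s IH] hs.
  near=> m; rewrite /lincomb /coef !big_nil scale0r /corner mulr0 mul0r //.
have hq : (size q.2.2 <= size w')%N by rewrite (leq_trans _ hN) ?hs ?mem_head.
have {}IH : \forall m \near \oo, corner (lincomb s) w w' z m = (coef s w w')%:A.
  by apply: IH => r hr; apply: hs; rewrite in_cons hr orbT.
near=> m; rewrite /lincomb /coef !big_cons scalerDl.
rewrite -/(lincomb s) -/(coef s w w').
have -> : (q.1 * (mono_coef q.2 w w')%:R)%:A = q.1 *: corner (mono q.2) w w' z m.
  rewrite -scalerA scaler_nat; congr (_ *: _); apply/esym; near: m.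
  exact: corner_mono.
have <- : corner (lincomb s) w w' z m = (coef s w w')%:A by near: m.
by rewrite /corner mulrDr mulrDl -scalerAr -scalerAl.
Unshelve. all: by end_near. Qed.

End Entries.

(** * Elements with zero entries vanish *)
Section Counting.

Lemma sum_leq_ord n c : (\sum_(k < n) (c <= k) = n - c)%N.
Proof.
by elim: n => [|n IH]; rewrite ?big_ord0 // big_ord_recr /= IH; case: leqP; lia.
Qed.

Lemma sum_ltn_ord n c : (\sum_(k < n) (k < c) <= c)%N.
Proof.
suff : (\sum_(k < n) (k < c) = minn n c)%N by move=> ->; exact: geq_minr.
by elim: n => [|n IH]; rewrite ?big_ord0 ?min0n // big_ord_recr /= IH; lia.
Qed.

Lemma sum_eq_ord n c : (\sum_(l < n) (l == c :> nat) = (c < n))%N.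
Proof.
by elim: n => [|n IH]; rewrite ?big_ord0 // big_ord_recr /= IH; lia.
Qed.

(** Counts the pairs of rungs of [ladder] that survive in a compressed monomial with
    words of lengths a and b; it is n up to the constant a + b. *)
Definition diag_count n a b := (\sum_(k < n) \sum_(l < n) (k + b == l + a))%N.

Lemma diag_count_le n a b : (diag_count n a b <= n)%N.
Proof.
rewrite -[leqRHS]card_ord -sum1_card; apply: leq_sum => k _.
apply: (@leq_trans (\sum_(l < n) (l == k + b - a :> nat))).
  by apply: leq_sum => l _; case: eqP => //= ?; case: eqP => //; lia.
by rewrite sum_eq_ord; case: (_ < _)%N.
Qed.

Lemma diag_count_ge n a b : (n <= diag_count n a b + (a + b))%N.
Proof.
have h : (n <= \sum_(k < n) ((\sum_(l < n) (k + b == l + a)) + (k < a) + (n - b <= k)))%N.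
  rewrite -[leqLHS]card_ord -sum1_card; apply: leq_sum => k _.
  have [//|ka] := ltnP k a; first by rewrite addn1 addSn.
  have [//|kb] := leqP (n - b) k; first by rewrite addn1.
  have hk : (k + b - a < n)%N by lia.
  rewrite (bigD1 (Ordinal hk)) //=; have -> : (k + b == k + b - a + a)%N by lia.
  by rewrite -!addnA.
move: h; rewrite !big_split /= -/(diag_count n a b) sum_leq_ord => h.
apply: (leq_trans h); rewrite -addnA leq_add2l leq_add ?sum_ltn_ord //.
by rewrite leq_subLR addnC -leq_subLR.
Qed.

End Counting.

Section Faithful.
Context {R : realType} {A : cstarAlgebra R} (S : 'I_2 -> A).
Context (cuntzS : is_cuntz2 S).
Implicit Types (x y b : A) (a : R[i]) (w t d : seq 'I_2) (z : nat -> 'I_2).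

Local Notation W := (cuntz_word S).

(** The canonical endomorphism: S_w x S_w^* summed over the words w of length k is its
    k-th iterate. *)
Definition endo x : A := \sum_i S i * x * star (S i).

Lemma star_endo x : star (endo x) = endo (star x).
Proof.
by rewrite star_sum; apply: eq_bigr => i _; rewrite !starM starK mulrA.
Qed.

Lemma star_endo_iter k x : star (iter k endo x) = iter k endo (star x).
Proof. by elim: k => //= k IH; rewrite star_endo IH. Qed.

Lemma endo_gen x i : endo x * S i = S i * x.
Proof.
rewrite /endo mulr_suml (bigD1 i) //= big1 => [|j ji].
  by rewrite addr0 -mulrA (star_gen cuntzS) eqxx mulr1.
by rewrite -mulrA (star_gen cuntzS) (negPf ji) mulr0.
Qed.

Lemma endoM x y : endo (x * y) = endo x * endo y.
Proof.
rewrite [in RHS]/endo mulr_sumr; apply: eq_bigr => i _.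
by rewrite !mulrA endo_gen -!mulrA.
Qed.

Lemma endo1 : endo 1 = 1.
Proof. by rewrite /endo -[RHS](cuntz_sum cuntzS); apply: eq_bigr => i _; rewrite mulr1. Qed.

Lemma endo0 : endo 0 = 0.
Proof. by rewrite /endo big1 // => i _; rewrite mulr0 mul0r. Qed.

Lemma endo_iterM k x y : iter k endo (x * y) = iter k endo x * iter k endo y.
Proof. by elim: k => //= k ->; rewrite endoM. Qed.

Lemma endo_iter_bool k (c : bool) : iter k endo c%:R = c%:R.
Proof. by elim: k => //= k ->; case: c; rewrite ?endo1 ?endo0. Qed.

Lemma endo_iter_word k x w : (size w <= k)%N ->
  iter k endo x * W w = W w * iter (k - size w) endo x.
Proof.
elim: w k => [|i w IH] [|k] //= hk; rewrite ?word_nil ?mulr1 ?mul1r //.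
by rewrite !word_cons mulrA endo_gen -mulrA IH // mulrA.
Qed.

Lemma endo_iter_star_word k x w : (size w <= k)%N ->
  star (W w) * iter k endo x = iter (k - size w) endo x * star (W w).
Proof.
move=> h; apply: (can_inj (@starK _ _)); rewrite !starM !star_endo_iter starK.
exact: endo_iter_word.
Qed.

(** For k < l the product is the k-th iterate of S_(z_m)^* endo^(l-k)(S_(z_m)), which
    compares z with its own tail after l - k letters; aperiodicity makes it vanish. *)
Lemma endo_iter_orth z k l : aperiodic z -> \forall m \near \oo,
  star (iter k endo (W (pre z m))) * iter l endo (W (pre z m)) = (k == l)%:R.
Proof.
move=> az.
have base j : \forall m \near \oo,
    star (W (pre z m)) * iter j endo (W (pre z m)) = (j == 0%N)%:R.
  have [->|j0] := eqVneq j 0%N; first by near=> m; rewrite star_wordK.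
  have [m0 h] : exists m0, forall m m', (m0 <= m)%N -> (m0 <= m')%N ->
      star (W ([::] ++ pre (stail j z) m)) * W ([::] ++ pre z m') = 0.
    apply: (star_word_scat cuntzS) => /(congr1 (stail 0)).
    rewrite (stail_scat [::]) (stail_scat [::] z).
    by move=> /(az j 0%N) e; rewrite e in j0.
  exists (j + m0)%N => // m /= hm.
  rewrite -(subnKC (leq_trans (leq_addr m0 j) hm)).
  set m' := (m - j)%N; rewrite {1}pre_cat word_cat starM -mulrA.
  rewrite endo_iter_star_word ?size_pre // subnn /= mulrA.
  by have := h m' (j + m')%N; rewrite /= => ->; rewrite ?mul0r //; lia.
have le i j : (i <= j)%N -> \forall m \near \oo,
    star (iter i endo (W (pre z m))) * iter j endo (W (pre z m)) = (i == j)%:R.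
  move=> ij; near=> m; rewrite star_endo_iter -(subnKC ij) iterD -endo_iterM.
  rewrite (_ : star _ * _ = (j - i == 0)%N%:R); last by near: m; exact: base.
  by rewrite endo_iter_bool; congr (_%:R); lia.
have [kl|/ltnW kl] := leqP k l; first exact: le.
near=> m; apply: (can_inj (@starK _ _)); rewrite starM starK.
rewrite (_ : star _ * _ = (l == k)%:R); last by near: m; exact: le.
by rewrite eq_sym; case: eqP; rewrite ?star1 ?star0.
Unshelve. all: by end_near. Qed.

(** A sum of n pairwise orthogonal isometries, when x is a long prefix word.  Starting at
    level p makes every word of length at most p pass through each rung. *)
Definition ladder p n x : A := \sum_(k < n) iter (p + k) endo x.

Lemma ladder_isometry z p n : aperiodic z -> \forall m \near \oo,
  star (ladder p n (W (pre z m))) * ladder p n (W (pre z m)) = n%:R.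
Proof.
move=> az.
have h : \forall m \near \oo, forall q : 'I_n * 'I_n,
    star (iter (p + q.1) endo (W (pre z m))) * iter (p + q.2) endo (W (pre z m))
    = (p + q.1 == p + q.2)%N%:R.
  by apply: filter_forall => q; exact: endo_iter_orth.
near=> m; have hm : forall q : 'I_n * 'I_n,
    star (iter (p + q.1) endo (W (pre z m))) * iter (p + q.2) endo (W (pre z m))
    = (p + q.1 == p + q.2)%N%:R by near: m.
rewrite star_sum mulr_suml -[n in RHS]card_ord -sum1_card natr_sum.
apply: eq_bigr => k _; rewrite mulr_sumr (bigD1 k) //= big1 => [|l lk].
  by have /= -> := hm (k, k); rewrite eqxx addr0.
by have /= -> := hm (k, l); rewrite eqn_add2l eq_sym (negPf (lk : (l : nat) != k)).
Unshelve. all: by end_near. Qed.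

(** The monomial with words of lengths a and b shifts rung l to rung l + a - b, and only
    equal rungs have a nonzero product. *)
Lemma ladder_mono z p n (q : seq 'I_2 * seq 'I_2) : aperiodic z ->
  (size q.1 <= p)%N -> (size q.2 <= p)%N -> \forall m \near \oo,
  star (ladder p n (W (pre z m))) * mono S q * ladder p n (W (pre z m)) =
  (diag_count n (size q.1) (size q.2))%:R *: mono S q.
Proof.
move=> az h1 h2.
pose P m (r : 'I_n * 'I_n) :=
  star (iter (p + r.1 - size q.1) endo (W (pre z m))) *
  iter (p + r.2 - size q.2) endo (W (pre z m))
  = (r.1 + size q.2 == r.2 + size q.1)%N%:R.
have h : \forall m \near \oo, forall r, P m r.
  apply: filter_forall => r; rewrite /P.
  apply: filterS (endo_iter_orth (p + r.1 - size q.1) (p + r.2 - size q.2) az) => m ->.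
  congr ((nat_of_bool _)%:R); move: h1 h2 (r.1 : nat) (r.2 : nat).
  move: (size q.1) (size q.2) => a c ha hc k l; lia.
near=> m; have hm : forall r, P m r by near: m.
rewrite star_sum !mulr_suml /diag_count natr_sum scaler_suml.
apply: eq_bigr => k _; rewrite mulr_sumr natr_sum scaler_suml.
apply: eq_bigr => l _; rewrite /mono star_endo_iter.
rewrite mulrA endo_iter_word ?(leq_trans h1) ?leq_addr //.
rewrite -!mulrA endo_iter_star_word ?(leq_trans h2) ?leq_addr //.
rewrite -star_endo_iter (mulrA (star (iter _ _ _))).
have /= -> := hm (k, l); case: eqP; rewrite ?scale1r ?mul1r //.
by rewrite scale0r mul0r mulr0.
Unshelve. all: by end_near. Qed.

Lemma nrm_gen i : nrm (S i) = 1.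
Proof. by rewrite -(word1 S) (nrm_word cuntzS). Qed.

(** Expanding both iterates yields finitely many corners of b. *)
Lemma endo_iter_small z b k l (e : R) : (forall w w', entry S b w w' z 0) -> 0 < e ->
  \forall m \near \oo,
  nrm (star (iter k endo (W (pre z m))) * b * iter l endo (W (pre z m))) < e.
Proof.
elim: k l b e => [|k IHk] l b e h e0; first elim: l b e h e0 => [|l IHl] b e h e0.
- apply: filterS (h [::] [::] e e0) => m.
  by rewrite scale0r subr0.
- have hi : \forall m \near \oo, forall i, nrm (star (iter 0 endo (W (pre z m))) *
      (b * S i) * iter l endo (W (pre z m))) < e / 2.
    apply: filter_forall => i; apply: IHl; last by rewrite divr_gt0.
    move=> w w' d d0; apply: filterS (h w (i :: w') d d0) => m.
    by rewrite /corner cat_cons word_cons !mulrA.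
  apply: filterS hi => m hm; rewrite iterS /endo -/endo mulr_sumr.
  apply: le_lt_trans (ler_nrm_sum _ _ _) _; rewrite big_ord_recl big_ord1.
  rewrite [e]splitr; apply: ltrD; apply: le_lt_trans (hm _);
    by rewrite !mulrA; apply: le_trans (ler_nrmM _ _) _; rewrite nrm_star nrm_gen mulr1.
- have hi : \forall m \near \oo, forall i, nrm (star (iter k endo (W (pre z m))) *
      (star (S i) * b) * iter l endo (W (pre z m))) < e / 2.
    apply: filter_forall => i; apply: IHk; last by rewrite divr_gt0.
    move=> w w' d d0; apply: filterS (h (i :: w) w' d d0) => m.
    by rewrite /corner cat_cons word_cons starM !mulrA.
  apply: filterS hi => m hm; rewrite star_endo_iter iterS /endo -/endo !mulr_suml.
  apply: le_lt_trans (ler_nrm_sum _ _ _) _; rewrite big_ord_recl big_ord1.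
  rewrite [e]splitr; apply: ltrD; apply: le_lt_trans (hm _);
    by rewrite star_endo_iter -!mulrA; apply: le_trans (ler_nrmM _ _) _;
       rewrite nrm_gen mul1r.
Qed.

Lemma nrm_ladder m n p z :
  star (ladder p n (W (pre z m))) * ladder p n (W (pre z m)) = n%:R ->
  forall x, nrm (star (ladder p n (W (pre z m))) * x * ladder p n (W (pre z m))) <=
    n%:R * nrm x.
Proof.
set T := ladder _ _ _ => hT x.
have hn : nrm T ^+ 2 = n%:R.
  by rewrite -nrm_sqr hT; have := nrmZnat n (1 : A); rewrite scaler_nat nrm1 mulr1.
apply: le_trans (ler_nrmM _ _) _.
apply: (@le_trans _ _ (nrm (star T) * nrm x * nrm T)).
  by rewrite ler_wpM2r ?nrm_ge0 // ler_nrmM.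
by rewrite nrm_star mulrAC -expr2 hn.
Qed.

Lemma ladder_lincomb z p n (s : seq (R[i] * (seq 'I_2 * seq 'I_2))) :
  aperiodic z ->
  (forall q, q \in s -> (size q.2.1 + size q.2.2 <= p)%N) ->
  \forall m \near \oo,
    nrm (star (ladder p n (W (pre z m))) * lincomb S s * ladder p n (W (pre z m))
     - n%:R *: lincomb S s) <=
    \sum_(q <- s) nrm (q.1%:A : A) * (size q.2.1 + size q.2.2)%:R.
Proof.
move=> az; rewrite /lincomb; elim: s => [|q s IH] hsz.
  by near=> m; rewrite !big_nil mulr0 mul0r scaler0 subrr nrm0.
have hq := hsz q (mem_head _ _).
have hs' r : r \in s -> (size r.2.1 + size r.2.2 <= p)%N.
  by move=> rs; apply: hsz; rewrite in_cons rs orbT.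
have {}IH := IH hs'.
have hm := ladder_mono n az (leq_trans (leq_addr _ _) hq) (leq_trans (leq_addl _ _) hq).
apply: filterS2 IH hm => m IH hm; rewrite !big_cons mulrDr mulrDl scalerDr.
rewrite opprD addrACA; apply: le_trans (ler_nrmD _ _) _; apply: lerD => //.
rewrite -scalerAr -scalerAl hm; set c := diag_count _ _ _.
rewrite scalerA mulrC -scalerA -scalerBl -nrmN -scaleNr opprB -natrB ?diag_count_le //.
rewrite nrmZnat nrmZ mulrCA ler_wpM2l ?nrm_ge0 //.
apply: (@le_trans _ _ (n - c)%:R).
  rewrite -[leRHS]mulr1 ler_wpM2l ?ler0n // /mono.
  by apply: nrm_le1M; rewrite ?nrm_star (nrm_word cuntzS).
by rewrite ler_nat leq_subLR; exact: diag_count_ge.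
Unshelve. all: by end_near. Qed.

(** Compress by a ladder T with n rungs.  T^* a T differs from n a by a constant that does
    not depend on n, for a a fixed combination close to b, while the norm of T^* x T is
    at most n times that of x, and T^* b T tends to 0 because it is made of corners of b.
    So n b is small compared with n. *)
Lemma entry0_eq0_at z b : aperiodic z -> (forall w w', entry S b w w' z 0) -> b = 0.
Proof.
move=> az h.
suff bnd (e : R) : 0 < e -> nrm b <= e + e + e.
  by apply: nrm_small => e e0; have := bnd (e / 3); lra.
move=> e0; have [s hs] := lincomb_dense cuntzS b e0.
pose C := \sum_(q <- s) nrm (q.1%:A : A) * (size q.2.1 + size q.2.2)%:R.
have C0 : 0 <= C by apply: sumr_ge0 => q _; rewrite mulr_ge0 ?nrm_ge0.
pose p := (\sum_(q <- s) (size q.2.1 + size q.2.2))%N.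
pose n := Num.bound ((C + 1) / e).
have hn : C + 1 < n%:R * e.
  by rewrite -ltr_pdivrMr // archi_boundP // divr_ge0 ?addr_ge0 // ltW.
have hsz q : q \in s -> (size q.2.1 + size q.2.2 <= p)%N.
  by move=> qs; rewrite /p (big_rem q) //= leq_addr.
have h1 : \forall m \near \oo,
    star (ladder p n (W (pre z m))) * ladder p n (W (pre z m)) = n%:R.
  exact: ladder_isometry.
have h2 := ladder_lincomb n az hsz.
have h3 : \forall m \near \oo,
    nrm (star (ladder p n (W (pre z m))) * b * ladder p n (W (pre z m))) <= 1.
  pose d : R := (n * n).+1%:R^-1.
  have d0 : 0 < d by rewrite invr_gt0.
  have hkl : \forall m \near \oo, forall r : 'I_n * 'I_n,
      nrm (star (iter (p + r.1) endo (W (pre z m))) * b *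
           iter (p + r.2) endo (W (pre z m))) < d.
    by apply: filter_forall => r; exact: endo_iter_small.
  apply: filterS hkl => m hm; rewrite star_sum !mulr_suml.
  apply: (@le_trans _ _ (\sum_(k < n) \sum_(l < n) d)).
    apply: le_trans (ler_nrm_sum _ _ _) _; apply: ler_sum => k _.
    rewrite mulr_sumr; apply: le_trans (ler_nrm_sum _ _ _) _.
    by apply: ler_sum => l _; exact: ltW (hm (k, l)).
  rewrite !sumr_const !card_ord -mulrnA -mulr_natl /d ler_pdivrMr ?ltr0Sn //.
  by rewrite mul1r ler_nat.
have [m [g1 g2 g3]] : exists m, [/\
    star (ladder p n (W (pre z m))) * ladder p n (W (pre z m)) = n%:R,
    nrm (star (ladder p n (W (pre z m))) * lincomb S s * ladder p n (W (pre z m))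
     - n%:R *: lincomb S s) <= C &
    nrm (star (ladder p n (W (pre z m))) * b * ladder p n (W (pre z m))) <= 1].
  by near \oo => m; exists m; split; near: m.
have g4 := nrm_ladder g1 (b - lincomb S s).
move: g1 g2 g3 g4; set T := ladder _ _ _ => g1 g2 g3 g4.
have nb : n%:R * nrm b <= n%:R * nrm (b - lincomb S s) + C + n%:R * nrm (b - lincomb S s) + 1.
  rewrite -(nrmZnat n b).
  have -> : n%:R *: b = n%:R *: (b - lincomb S s) -
      (star T * lincomb S s * T - n%:R *: lincomb S s) -
      star T * (b - lincomb S s) * T + star T * b * T.
    by rewrite mulrBr mulrBl scalerBr !opprB !addrA !subrK.
  apply: le_trans (ler_nrmD _ _) _; apply: lerD => //.
  apply: le_trans (ler_nrmB _ _) _; apply: lerD => //.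
  apply: le_trans (ler_nrmB _ _) _; apply: lerD => //.
  by rewrite nrmZnat.
have n0 : 0 < n%:R :> R by nra.
rewrite -(ler_pM2l n0); have := ler_wpM2l (ltW n0) (ltW hs); nra.
Unshelve. all: by end_near. Qed.

End Faithful.

(** * Elements with entries 0 and 1 *)
Section ZeroOne.
Context {R : realType} {A : cstarAlgebra R} (S : 'I_2 -> A).
Context (cuntzS : is_cuntz2 S).
Implicit Types (x y b : A) (a : R[i]) (w t d : seq 'I_2) (z : nat -> 'I_2).

Local Notation W := (cuntz_word S).
Local Notation words := (seq 'I_2).
Local Notation entry := (entry S).
Local Notation corner := (corner S).

Lemma cat_injl (T : Type) (u : seq T) : injective (cat^~ u).
Proof.
move=> v v' e; have hs : size v = size v'.
  by have := congr1 size e; rewrite !size_cat => /addIn.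
by have := congr1 (take (size v)) e; rewrite /= take_size_cat // hs take_size_cat.
Qed.

Lemma drop_catr (T : Type) n (u v : seq T) : (n <= size u)%N ->
  drop n (u ++ v) = drop n u ++ v.
Proof.
move=> h; rewrite drop_cat; case: ltnP => // h'.
have -> : n = size u by lia.
by rewrite subnn drop0 drop_size.
Qed.

Lemma mono_coef_cat (p : words * words) w w' t : (size p.2 <= size w')%N ->
  mono_coef p (w ++ t) (w' ++ t) = mono_coef p w w'.
Proof.
move=> h; rewrite /mono_coef takel_cat // drop_catr // catA.
by rewrite (inj_eq (@cat_injl _ t)).
Qed.

Lemma coef_cat (s : seq (R[i] * (words * words))) N w w' t :
  short N s -> (N <= size w')%N -> coef s (w ++ t) (w' ++ t) = coef s w w'.
Proof.
move=> hs hN; rewrite /coef; apply: eq_big_seq => q qs.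
by rewrite mono_coef_cat // (leq_trans _ hN) // hs.
Qed.

Lemma corner_near_coef b s N w w' z (e : R) :
  nrm (b - lincomb S s) < e -> short N s -> (N <= size w')%N -> aperiodic z ->
  \forall m \near \oo, nrm (corner b w w' z m - (coef s w w')%:A) < e.
Proof.
move=> hs sN hN az; apply: filterS (corner_lincomb cuntzS w sN hN az) => m <-.
by rewrite -cornerB; apply: le_lt_trans hs; exact: nrm_corner.
Qed.

Lemma entry_near_coef b s N w w' z a (e : R) : 0 < e ->
  nrm (b - lincomb S s) < e -> short N s -> (N <= size w')%N -> aperiodic z ->
  entry b w w' z a -> nrm (a%:A - (coef s w w')%:A : A) < e + e.
Proof.
move=> e0 hs sN hN az h; apply: (entry_dist h e0).
exact: corner_near_coef hs sN hN az.
Qed.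

(** One tail z for each pair of words is enough: an approximation of b has entries that
    are constant on cylinders, so an entry of b that vanishes at one point of a deep
    cylinder is small on all of it. *)
Lemma entry0_eq0 b :
  (forall w w', exists2 z, aperiodic z & entry b w w' z 0) -> b = 0.
Proof.
move=> h; have az := pow2_stream_aperiodic; set z := pow2_stream in az.
apply: (entry0_eq0_at cuntzS az) => w w' e e0.
have e3 : 0 < e / 3 by rewrite divr_gt0.
have [s [N [hs sN]]] := short_approx cuntzS b e3.
rewrite -(scat_pre N z); set t := pre z N.
have hN : (N <= size (w' ++ t))%N by rewrite size_cat size_pre leq_addl.
have [z' az' h'] := h (w ++ t) (w' ++ t).
have c0 := entry_near_coef e3 hs sN hN az' h'; rewrite scale0r sub0r nrmN in c0.
have az1 := @aperiodic_stail N z az.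
have h1 := corner_near_coef (w ++ t) hs sN hN az1.
apply/(near_addl (size t)); apply: filterS h1 => m h1.
rewrite corner_scat scale0r subr0 -(subrK (coef s (w ++ t) (w' ++ t))%:A (corner _ _ _ _ _)).
by apply: le_lt_trans (ler_nrmD _ _) _; lra.
Qed.

(** By local constancy up to a small error, one tail for each pair of words determines
    the entries at all of them. *)
Definition zero_one b := forall w w', exists (g : bool) z, aperiodic z /\ entry b w w' z g%:R.

(** An approximation within 1/4 tells the entries 0 and 1 apart. *)
Lemma bool_close (g g' : bool) x : nrm (g%:R%:A - x) < 1 / 4 ->
  nrm (g'%:R%:A - x) < 1 / 4 -> g = g'.
Proof.
move=> h h'; have : nrm (g%:R%:A - g'%:R%:A : A) < 1 / 2.
  have -> : g%:R%:A - g'%:R%:A = (g%:R%:A - x) - (g'%:R%:A - x).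
    by rewrite opprB addrA subrK.
  by apply: le_lt_trans (ler_nrmB _ _) _; lra.
case: g g' {h h'} => -[] //; rewrite !(scale1r, scale0r) ?subr0 ?sub0r ?nrmN nrm1; lra.
Qed.

Lemma coef_support (s : seq (R[i] * (words * words))) N : exists X : seq (words * words),
  forall w w', size w' = N -> coef s w w' != 0 -> (w, w') \in X.
Proof.
elim: s => [|q s [X hX]]; first by exists [::] => w w' _; rewrite /coef big_nil eqxx.
pose L := [seq (q.2.1 ++ val t, q.2.2 ++ val t) | t : (N - size q.2.2).-tuple 'I_2].
exists (L ++ X) => w w' hw; rewrite /coef big_cons -/(coef s w w') mem_cat.
case hq: (mono_coef q.2 w w'); last first.
  by rewrite mulr0 add0r => /(hX _ _ hw) ->; rewrite orbT.
move=> _; apply/orP; left; move: hq; rewrite /mono_coef => /andP[/eqP h1 /eqP h2].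
have hsz : size (drop (size q.2.2) w') == (N - size q.2.2)%N by rewrite size_drop hw.
apply/mapP; exists (Tuple hsz); first by rewrite mem_enum.
by rewrite /= -h2 -[X in (_, X ++ _)]h1 cat_take_drop.
Qed.

(** Approximate b by a combination that acts on the first N letters only.  The entries of
    b at (w t, w' t) with |w'| = N are all equal to the value in {0, 1} nearest to the
    coefficient of the approximation at (w, w'), so b has the same entries as the sum of
    the monomials (w, w') for which this value is 1; these lie in the finite support of
    the approximation. *)
Lemma zero_one_sum b : zero_one b ->
  exists s : seq (words * words), [/\ uniq s, b = \sum_(p <- s) mono S p &
    forall p, p \in s -> exists2 z, aperiodic z & entry b p.1 p.2 z 1].
Proof.
move=> hb; have e8 : 0 < 1 / 8 :> R by lra.
have [s0 [N [hs sN]]] := short_approx cuntzS b e8.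
have close w w' z (g : bool) : aperiodic z -> (N <= size w')%N ->
    entry b w w' z g%:R -> nrm (g%:R%:A - (coef s0 w w')%:A : A) < 1 / 4.
  move=> az hN h; have := entry_near_coef e8 hs sN hN az h; lra.
have [X hX] := coef_support s0 N.
pose J := [seq p <- undup X | (size p.2 == N) &&
  `[< exists2 z, aperiodic z & entry b p.1 p.2 z 1 >]].
have uJ : uniq J by rewrite filter_uniq // undup_uniq.
have JN p : p \in J -> size p.2 = N.
  by rewrite mem_filter => /andP[/andP[/eqP]].
exists J; split => //; last first.
  by move=> p; rewrite mem_filter => /andP[/andP[_ /asboolP]].
apply/eqP; rewrite -subr_eq0; apply/eqP; apply: entry0_eq0 => w0 w0'.
pose t0 : words := nseq N ord0; pose w := w0 ++ t0; pose w' := w0' ++ t0.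
have hN : (N <= size w')%N by rewrite size_cat size_nseq leq_addl.
have [g [z [az hg]]] := hb w w'.
exists (scat t0 z); first exact: aperiodic_scat.
apply/entry_scat; have -> : 0 = g%:R - g%:R :> R[i] by rewrite subrr.
apply: (entryB hg).
pose s1 : seq (R[i] * (words * words)) := [seq (1, p) | p <- J].
have s1N : short N s1 by move=> q /mapP[p pJ ->]; rewrite /= JN.
have -> : \sum_(p <- J) mono S p = lincomb S s1.
  by rewrite /lincomb big_map; apply: eq_bigr => p _; rewrite scale1r.
apply: entry_exact; apply: filterS (corner_lincomb cuntzS w s1N hN az) => m ->.
congr (_ *: _); rewrite /coef big_map.
under eq_bigr do rewrite mul1r; rewrite -natr_sum; congr (_%:R).
pose v := take N w'; pose t := drop N w'.
have vN : size v = N by rewrite size_takel.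
have w'E : w' = v ++ t by rewrite cat_take_drop.
have cE p : p \in J -> mono_coef p w w' = (p.2 == v) && (w == p.1 ++ t).
  by move=> /JN pN; rewrite /mono_coef pN -/v -/t eq_sym.
have [[u wE]|nu] := pselect (exists u, w = u ++ t); last first.
  have c0 : coef s0 w w' = 0.
    rewrite /coef big1_seq // => q /= qs; case hq: (mono_coef _ _ _); last by rewrite mulr0.
    case: nu; move/andP: hq => [_ /eqP ->]; exists (q.2.1 ++ drop (size q.2.2) v).
    by rewrite -catA -drop_catr ?vN ?sN // -w'E.
  have := close w w' z g az hN hg; rewrite c0 => cg.
  have -> : g = false by apply: (bool_close cg); rewrite subrr nrm0; lra.
  rewrite big1_seq // => p /= pJ; rewrite cE //; case: eqP => //= _.
  by case: eqP => // e; case: nu; exists p.1.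
have cuv : coef s0 w w' = coef s0 u v.
  by rewrite wE w'E (coef_cat _ _ sN) // vN.
have -> : g = ((u, v) \in J).
  have cg := close w w' z g az hN hg; rewrite cuv in cg.
  apply/idP/idP => [gT|]; last first.
    rewrite mem_filter => /andP[/andP[_ /asboolP[z' az' h']]] _.
    have := close u v z' true az'; rewrite vN => /(_ (leqnn _) h') c1.
    by rewrite (bool_close cg c1).
  have [g' [z' [az' h']]] := hb u v.
  have := close u v z' g' az'; rewrite vN => /(_ (leqnn _) h') c1.
  have g'g := bool_close c1 cg; rewrite g'g gT in h'.
  rewrite mem_filter vN eqxx mem_undup /=; apply/andP; split.
    by apply/asboolP; exists z'.
  apply: hX => //; apply/eqP => c0; move: cg; rewrite gT c0 scale0r subr0 scale1r nrm1; lra.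
rewrite -(count_uniq_mem _ uJ) -sum1_count [RHS]big_mkcond /=.
apply: eq_big_seq => p pJ.
rewrite cE // wE (inj_eq (@cat_injl _ t)) [in RHS]/eq_op /= andbC [u == _]eq_sym.
by case: (_ && _).
Qed.

End ZeroOne.

(** * Dynamics on infinite words *)
Section Dynamics.
Context {R : realType} {A : cstarAlgebra R} (S : 'I_2 -> A).
Context (cuntzS : is_cuntz2 S).
Implicit Types (x y b v : A) (a : R[i]) (w t d u : seq 'I_2) (z : nat -> 'I_2).

Local Notation W := (cuntz_word S).
Local Notation words := (seq 'I_2).
Local Notation entry := (entry S).
Local Notation corner := (corner S).

Lemma near_seq (T : eqType) (L : seq T) (P : T -> nat -> Prop) :
  (forall k, \forall m \near \oo, P k m) ->
  \forall m \near \oo, forall k, k \in L -> P k m.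
Proof.
move=> h; elim: L => [|k L IH]; first by near=> m.
apply: filterS2 (h k) IH => m hk hL i; rewrite in_cons => /predU1P[->//|].
exact: hL.
Unshelve. all: by end_near. Qed.

Lemma isometryM v v' : star v * v = 1 -> star v' * v' = 1 ->
  star (v * v') * (v * v') = 1.
Proof. by move=> h h'; rewrite starM -mulrA (mulrA (star v)) h mul1r. Qed.

Lemma isometryX v n : star v * v = 1 -> star (v ^+ n) * v ^+ n = 1.
Proof.
move=> h; elim: n => [|n IH]; first by rewrite expr0 star1 mulr1.
by rewrite exprS; exact: isometryM.
Qed.

(** A sum of monomials sends a long prefix word to a sum of words; its square norm counts
    the pairs of equal words among them, so an isometry produces exactly one. *)
Lemma nat_span_isometry_word v w z : nat_span S v -> star v * v = 1 ->
  aperiodic z -> exists j u, v * W (w ++ pre z j) = W u.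
Proof.
move=> [s vE] vv az.
pose j := (\sum_(p <- s) size p.2)%N; pose x := w ++ pre z j; exists j.
pose L := [seq p.1 ++ drop (size p.2) x | p <- s & take (size p.2) x == p.2].
have vx t : v * W (x ++ t) = \sum_(u <- L) W (u ++ t).
  rewrite vE mulr_suml big_map big_filter [RHS]big_mkcond /=; apply: eq_big_seq => p ps.
  have hp : (size p.2 <= size x)%N.
    by rewrite size_cat size_pre /j (big_rem p) //= addnCA leq_addr.
  rewrite /mono -mulrA (word_cat S x) mulrA -mulrA (mulrA (star _)).
  rewrite (star_word_word cuntzS) //; case: eqP => _; last by rewrite mul0r mulr0.
  by rewrite -!word_cat catA.
pose z' := stail j z; have az' : aperiodic z' := @aperiodic_stail j z az.
have : \forall m \near \oo, forall r, r \in [seq (u, u') | u <- L, u' <- L] ->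
    star (W (r.1 ++ pre z' m)) * W (r.2 ++ pre z' m) = (r.1 == r.2)%:R.
  by apply: near_seq => r; exact: star_word_aperiodic.
case=> m _ /(_ m (leqnn m)) hm.
have one : (1 : A) = (\sum_(u <- L) \sum_(u' <- L) (u == u'))%N%:R.
  transitivity (star (v * W (x ++ pre z' m)) * (v * W (x ++ pre z' m))).
    by apply/esym/isometryM => //; exact: star_wordK.
  rewrite vx star_sum mulr_suml natr_sum; apply: eq_big_seq => u uL.
  rewrite mulr_sumr natr_sum; apply: eq_big_seq => u' u'L.
  by rewrite (hm (u, u')) //; apply/allpairsP; exists (u, u').
have cnt : (\sum_(u <- L) \sum_(u' <- L) (u == u') = 1)%N.
  apply/eqP; rewrite -(eqr_nat R); have := congr1 (@nrm R A) one.
  rewrite nrm1; set k := (\sum_(u <- L) _)%N => e1.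
  by have := nrmZnat k (1 : A); rewrite scaler_nat nrm1 mulr1 -e1 => <-.
have szL : (size L <= 1)%N.
  rewrite -[leqRHS]cnt -sum1_size big_seq [leqRHS]big_seq.
  apply: leq_sum => u uL.
  by rewrite (big_rem u) //= eqxx.
have := vx [::]; move: cnt szL; case: L {vx hm one} => [|u []] //.
  by rewrite big_nil.
by move=> _ _; rewrite big_seq1 !cats0 => h; exists u.
Qed.

(** As b = (v^n)^* b, the row wz of b is also its row at the image of wz under v^n, for
    every n, and these images are pairwise distinct.  An approximation of b by K monomials has
    at most K nonzero entries in a column, so among K + 1 points of the orbit one meets a
    zero. *)
Lemma entry_wandering v b w w' z : nat_span S v -> star v * v = 1 ->
  v * b = b -> aperiodic z ->
  (forall n j, (0 < n)%N -> v ^+ n * W (w ++ pre z j) <> W (w ++ pre z j)) ->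
  entry b w w' z 0.
Proof.
move=> sv vv vb az wand e e0.
have vnb n : star (v ^+ n) * b = b.
  have vn : v ^+ n * b = b by elim: n => [|n IH]; rewrite ?mul1r // exprSr -mulrA vb.
  by rewrite -{1}vn mulrA isometryX // mul1r.
have [s [N [hs sN]]] := short_approx cuntzS b e0.
have step n : exists ju : nat * words, v ^+ n * W (w ++ pre z ju.1) = W ju.2.
  have [j [u h]] := nat_span_isometry_word w (nat_spanX cuntzS n sv) (isometryX n vv) az.
  by exists (j, u).
have {step} [f hf] := choice step.
pose K := (size s).+1.
pose j := (N + \sum_(n < K) (f n).1)%N.
have jf n : (n < K)%N -> ((f n).1 <= j)%N.
  by move=> h; rewrite /j (bigD1 (Ordinal h)) //= addnCA leq_addr.
pose z' := stail j z; have az' : aperiodic z' := @aperiodic_stail j z az.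
pose U n := (f n).2 ++ pre (stail (f n).1 z) (j - (f n).1).
have hU n : (n < K)%N -> v ^+ n * W (w ++ pre z j) = W (U n).
  move=> nK; rewrite /U (word_cat S (f n).2) -hf -mulrA -word_cat -catA -pre_cat.
  by rewrite subnKC ?jf.
have Uinj : uniq [seq U n | n <- iota 0 K].
  rewrite map_inj_in_uniq ?iota_uniq // => n n'; rewrite !mem_iota /= !add0n.
  wlog lt : n n' / (n < n')%N => [wl|] hn hn' e'.
    case: (ltngtP n n') => // lt; first exact: wl.
    by apply/esym; apply: wl.
  case: (wand (n' - n)%N j); first by rewrite subn_gt0.
  rewrite -[in RHS](mul1r (W _)) -(isometryX n vv) -mulrA (hU n hn) e' -(hU n' hn').
  by rewrite -{2}(subnKC (ltnW lt)) exprD -mulrA mulrA isometryX // mul1r.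
pose w2 := w' ++ pre z j.
have hN : (N <= size w2)%N by rewrite size_cat size_pre; lia.
pose C := [seq q.2.1 ++ drop (size q.2.2) w2 | q <- s].
have [n nK hn] : exists2 n, (n < K)%N & U n \notin C.
  apply: contrapT => H.
  have /(uniq_leq_size Uinj) : {subset [seq U n | n <- iota 0 K] <= C}.
    move=> y /mapP[n + ->]; rewrite mem_iota add0n /= => nK.
    by apply: contrapT => h; apply: H; exists n => //; exact/negP.
  by rewrite !size_map size_iota ltnn.
have c0 : coef s (U n) w2 = 0.
  rewrite /coef big1_seq // => q /= qs; case hq: (mono_coef _ _ _); last by rewrite mulr0.
  by move: hn; move/andP: hq => [_ /eqP ->]; rewrite (map_f (fun q => _ ++ _) qs).
apply/(near_addl j); apply: filterS (corner_near_coef cuntzS (U n) hs sN hN az') => m.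
rewrite c0; set l := corner _ _ _ _ _; set r := corner _ _ _ _ _.
suff -> : r = l by [].
have vw : v ^+ n * W (w ++ pre z (j + m)) = W (U n ++ pre z' m).
  by rewrite pre_cat catA word_cat mulrA hU // -word_cat.
rewrite /l /r /corner -vw starM /w2 -catA -pre_cat; congr (_ * _).
by rewrite -mulrA vnb.
Qed.

End Dynamics.

(** * Copies of the generator x_0 of F *)
Section ThompsonElements.
Context {R : realType} {A : cstarAlgebra R} (S : 'I_2 -> A).
Context (cuntzS : is_cuntz2 S).
Implicit Types (x y b v : A) (a : R[i]) (w t d u : seq 'I_2) (z : nat -> 'I_2).

Local Notation W := (cuntz_word S).
Local Notation words := (seq 'I_2).

Lemma rev_ord2_neq (i : 'I_2) : (rev_ord i == i) = false.
Proof. by case: i => -[|[]]. Qed.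

Lemma ord2_cases (i j : 'I_2) : (j == i) || (j == rev_ord i).
Proof. by case: i => -[|[]] // ?; case: j => -[|[]]. Qed.

Lemma sum_ord2 (T : nmodType) (F : 'I_2 -> T) i : \sum_j F j = F i + F (rev_ord i).
Proof.
rewrite (bigD1 i) //= (bigD1 (rev_ord i)) ?rev_ord2_neq //= big1 ?addr0 // => j.
by move=> /andP[ji]; have := ord2_cases i j; rewrite (negPf ji) /= => ->.
Qed.

(** The generator x_0, with the pairs of words 00 <- 0, 01 <- 10 and 1 <- 11. *)
Definition thompson_x : A :=
  S ord0 * S ord0 * star (S ord0) + S ord0 * S ord_max * star (S ord_max * S ord0)
  + S ord_max * star (S ord_max * S ord_max).

(** Exchanging the two letters turns x_0 into its inverse; [push i] moves every point
    other than the two constant ones towards the constant word in the letter i. *)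
Definition push (i : 'I_2) : A := if i == ord0 then thompson_x else star thompson_x.

Lemma star_push (i : 'I_2) : star (push i) = push (rev_ord i).
Proof. by rewrite /push; case: i => -[|[]] // ?; rewrite /= ?starK. Qed.

Local Notation SS := (star_gen cuntzS).

Lemma x_S0 : thompson_x * S ord0 = S ord0 * S ord0.
Proof.
rewrite /thompson_x !mulrDl !starM -!mulrA !SS /= !mulr0 !addr0.
by rewrite mulr1.
Qed.

Lemma x_S10 : thompson_x * S ord_max * S ord0 = S ord0 * S ord_max.
Proof.
rewrite /thompson_x !mulrDl !starM -!mulrA !(mulrA (star (S _)) (S _) (S ord0)) !SS /=.
by rewrite !(mul0r, mul1r, mulr0, mulr1, SS, add0r, addr0).
Qed.

Lemma x_S11 : thompson_x * S ord_max * S ord_max = S ord_max.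
Proof.
rewrite /thompson_x !mulrDl !starM -!mulrA !(mulrA (star (S _)) (S _) (S ord_max)) !SS /=.
by rewrite !(mul0r, mul1r, mulr0, mulr1, SS, add0r, addr0).
Qed.

Lemma eq_mul_gen x y : (forall i, x * S i = y * S i) -> x = y.
Proof.
move=> h; rewrite -(mulr1 x) -(mulr1 y) -(cuntz_sum cuntzS) !mulr_sumr.
by apply: eq_bigr => i _; rewrite !mulrA h.
Qed.

Lemma ord2P (i : 'I_2) : i = ord0 \/ i = ord_max.
Proof. by case: i => -[|[]] // ?; [left|right]; apply: val_inj. Qed.

Lemma x_unitary : cstar_unitary thompson_x.
Proof.
have sX : star thompson_x = S ord0 * star (S ord0 * S ord0)
    + S ord_max * S ord0 * star (S ord0 * S ord_max)
    + S ord_max * S ord_max * star (S ord_max).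
  by rewrite /thompson_x !starD !starM !starK !mulrA.
have y0 : star thompson_x * S ord0 * S ord0 = S ord0.
  rewrite sX !mulrDl !starM -!mulrA !(mulrA (star (S _)) (S _) (S ord0)) !SS /=.
  by rewrite !(mul0r, mul1r, mulr0, mulr1, SS, add0r, addr0).
have y01 : star thompson_x * S ord0 * S ord_max = S ord_max * S ord0.
  rewrite sX !mulrDl !starM -!mulrA !(mulrA (star (S _)) (S _) (S ord_max)) !SS /=.
  by rewrite !(mul0r, mul1r, mulr0, mulr1, SS, add0r, addr0).
have y1 : star thompson_x * S ord_max = S ord_max * S ord_max.
  rewrite sX !mulrDl !starM -!mulrA !SS /=.
  by rewrite !(mul0r, mul1r, mulr0, mulr1, SS, add0r, addr0).
split; apply: eq_mul_gen => i; rewrite mul1r; case: (ord2P i) => ->.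
- by rewrite -mulrA x_S0 mulrA y0.
- apply: eq_mul_gen => j; rewrite -!mulrA (mulrA thompson_x); case: (ord2P j) => ->.
    by rewrite x_S10 mulrA y01.
  by rewrite x_S11 y1.
- apply: eq_mul_gen => j; rewrite -!mulrA (mulrA (star thompson_x)); case: (ord2P j) => ->.
    by rewrite y0 x_S0.
  by rewrite y01 mulrA x_S10.
- by rewrite -mulrA y1 mulrA x_S11.
Qed.

Lemma push_gen i : push i * S i = S i * S i.
Proof.
case: (ord2P i) => ->; rewrite /push /=; first exact: x_S0.
by rewrite -{1}x_S11 !mulrA (proj1 x_unitary) mul1r.
Qed.

Lemma push_rev_gen i : push i * S (rev_ord i) * S i = S i * S (rev_ord i).
Proof.
case: (ord2P i) => ->; rewrite /push /=.
  by rewrite (_ : rev_ord _ = ord_max) ?x_S10 //; exact: val_inj.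
rewrite (_ : rev_ord _ = ord0) /=; last exact: val_inj.
by rewrite -mulrA -x_S10 !mulrA (proj1 x_unitary) mul1r.
Qed.

Lemma push_rev_rev i : push i * S (rev_ord i) * S (rev_ord i) = S (rev_ord i).
Proof.
rewrite -mulrA -push_gen mulrA -star_push.
suff -> : push i * star (push i) = 1 by rewrite mul1r.
by rewrite /push; case: ifP => _; rewrite ?starK; case: x_unitary.
Qed.

(** x acting inside the cylinder of u, and the identity elsewhere. *)
Fixpoint copy_at u x : A := if u is i :: u' then
  S i * copy_at u' x * star (S i) + S (rev_ord i) * star (S (rev_ord i)) else x.

Lemma copy_atE u x : copy_at u x = W u * x * star (W u) + (1 - W u * star (W u)).
Proof.
elim: u => [|i u IH] /=; first by rewrite word_nil star1 !mulr1 mul1r subrr addr0.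
rewrite IH word_cons starM mulrDr mulrDl mulrBr mulrBl !mulr1 !mulrA -addrA.
congr (_ + _); rewrite -(cuntz_sum cuntzS) (sum_ord2 _ i).
by rewrite addrAC.
Qed.

Lemma star_copy_at u x : star (copy_at u x) = copy_at u (star x).
Proof. by rewrite !copy_atE starD starB star1 !starM !starK mulrA. Qed.

Lemma star_word_copy_at u x : star (W u) * copy_at u x = x * star (W u).
Proof.
rewrite copy_atE mulrDr mulrBr mulr1 !mulrA (star_wordK cuntzS).
by rewrite !mul1r subrr addr0.
Qed.

Lemma copy_at_compl u x : copy_at u x * (1 - W u * star (W u)) = 1 - W u * star (W u).
Proof.
have h : star (W u) * (1 - W u * star (W u)) = 0.
  by rewrite mulrBr mulr1 mulrA (star_wordK cuntzS) mul1r subrr.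
by rewrite copy_atE mulrDl -mulrA h mulr0 add0r mulrBl mul1r -mulrA h mulr0 subr0.
Qed.

Lemma copy_at_unitary u x : cstar_unitary x -> cstar_unitary (copy_at u x).
Proof.
have aux y y' : y' * y = 1 -> copy_at u y' * copy_at u y = 1.
  move=> yy; rewrite {1}copy_atE mulrDl -mulrA star_word_copy_at.
  rewrite mulrA -(mulrA (W u)) yy mulr1 mulrBl mul1r -(mulrA (W u)) star_word_copy_at.
  by rewrite copy_atE mulrA addrAC subrr add0r addrCA subrr addr0.
by move=> [h1 h2]; split; rewrite star_copy_at; exact: aux.
Qed.

Lemma push_iter_strip i j b :
  push i ^+ j * (S (rev_ord i) ^+ j.+1 * b) = S (rev_ord i) * b.
Proof.
elim: j => [|j IH]; first by rewrite expr0 mul1r expr1.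
rewrite exprSr -mulrA -IH; congr (_ * _).
by rewrite 2!exprS !mulrA push_rev_rev -exprS.
Qed.

Lemma push_iter_grow i j b : push i ^+ j * (S i * b) = S i ^+ j.+1 * b.
Proof.
elim: j => [|j IH]; first by rewrite expr0 mul1r expr1.
by rewrite exprS -mulrA IH !exprS !mulrA push_gen.
Qed.

Lemma mixed_ext u : exists t (i : 'I_2) k t',
  u ++ t = nseq k.+1 i ++ rev_ord i :: t'.
Proof.
elim: u => [|i u [t [l [k [t' e]]]]].
  by exists [:: ord0; rev_ord ord0], ord0, 0%N, [::].
case/orP: (ord2_cases i l) => /eqP li.
  by exists t, i, k.+1, t'; rewrite /= e li.
exists t, i, 0%N, (nseq k l ++ rev_ord l :: t').
by rewrite /= e /= li.
Qed.

Lemma word_nseq k i : W (nseq k i) = S i ^+ k.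
Proof. by elim: k => [|k IH]; rewrite ?word_nil // word_cons IH exprS. Qed.

Lemma isometry_gen i : star (S i) * S i = 1.
Proof. exact: (cuntz_isometry cuntzS). Qed.

(** x_0 shortens an initial run of the letter 1 and lengthens an initial run of the letter
    0, so that words with both letters drift without return.  Words with a single letter
    are reduced to these by appending letters. *)
Lemma x_iter_no_fixed_word u n : (0 < n)%N -> thompson_x ^+ n * W u <> W u.
Proof.
move=> n0 fix_u.
have base k t : thompson_x ^+ n * (S ord0 ^+ k.+1 * (S ord_max * W t)) <>
    S ord0 ^+ k.+1 * (S ord_max * W t).
  rewrite {1}exprS -mulrA -[thompson_x]/(push ord0) push_iter_grow mulrA -exprD => e.
  have iso := isometryX k.+1 (isometry_gen ord0).
  have := congr1 (fun y => star (S ord_max) * (star (S ord0 ^+ k.+1) * y)) e.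
  rewrite addSnnS addnC exprD -(mulrA (_ ^+ k.+1)) !(mulrA (star (S ord0 ^+ k.+1))) iso.
  rewrite !mul1r !mulrA isometry_gen mul1r -(prednK n0) exprS !mulrA SS !mul0r => /esym/eqP.
  exact/negP/word_neq0.
have fix_ut t : thompson_x ^+ n * W (u ++ t) = W (u ++ t).
  by rewrite word_cat mulrA fix_u.
have [t [i [k [t' e]]]] := mixed_ext u.
have := fix_ut t; rewrite e word_cat word_cons word_nseq.
case: (ord2P i) => ->.
  by rewrite (_ : rev_ord _ = ord_max) //; [exact: base | exact: val_inj].
rewrite (_ : rev_ord _ = ord0) //; last exact: val_inj.
set y := S ord_max ^+ _ * _ => fix_y.
have r0 : rev_ord ord0 = ord_max :> 'I_2 by exact: val_inj.
(* x_0^(k+1) removes the run of ones and enters the first case. *)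
have xy : thompson_x ^+ k.+1 * y = S ord0 ^+ 1 * (S ord_max * W t').
  have := push_iter_strip ord0 k (S ord0 * W t'); rewrite r0 /push /= => strip.
  by rewrite exprS -mulrA strip !mulrA x_S10 expr1.
apply: (base 0%N t'); rewrite -xy mulrA -exprD addnC exprD -mulrA fix_y //.
Qed.

(** Every point wanders under x_0^n, so all the rows of b vanish. *)
Lemma x_iter_fix_eq0 n b : (0 < n)%N -> thompson_x ^+ n * b = b -> b = 0.
Proof.
move=> n0 fix_b; apply: (entry0_eq0 cuntzS) => w w'; exists pow2_stream.
  exact: pow2_stream_aperiodic.
have sx : nat_span S thompson_x.
  exists [:: ([:: ord0; ord0], [:: ord0]); ([:: ord0; ord_max], [:: ord_max; ord0]);
    ([:: ord_max], [:: ord_max; ord_max])].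
  by rewrite !big_cons big_nil addr0 addrA /mono /= !word_cons !word_nil !mulr1.
apply: (@entry_wandering _ _ _ cuntzS (thompson_x ^+ n)) => //.
- exact: nat_spanX.
- by apply: isometryX; case: x_unitary.
- exact: pow2_stream_aperiodic.
- by move=> m j m0; rewrite -exprM; apply: x_iter_no_fixed_word; rewrite muln_gt0 n0.
Qed.

Lemma copy_at_fix_eq0 u n b : (0 < n)%N -> copy_at u thompson_x ^+ n * b = b ->
  star (W u) * b = 0.
Proof.
move=> n0 fix_b; apply: (x_iter_fix_eq0 n0); rewrite -{2}fix_b !mulrA; congr (_ * _).
elim: n {n0 fix_b} => [|n IH]; first by rewrite !expr0 mul1r mulr1.
by rewrite !exprS -mulrA IH !mulrA star_word_copy_at.
Qed.

Lemma copy_at_conj_iter u j x y : copy_at u x ^+ j * (W u * y) = W u * (x ^+ j * y).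
Proof.
elim: j => [|j IH]; first by rewrite !expr0 !mul1r.
rewrite !exprS -!mulrA IH copy_atE mulrDl mulrBl mul1r -!mulrA.
by rewrite !(mulrA (star (W u))) (star_wordK cuntzS) !mul1r subrr addr0.
Qed.

(** On the cylinder of j...ji', with i' the letter other than j, prefixing the letter i
    agrees with an element of F.  If j = i one push does it.  Otherwise pushing k + 2
    times turns this word into iij, and pushing back inside the cylinder of i restores the
    run behind the first i. *)
Lemma gen_mul_runE i j k : exists2 h, S i * W (nseq k.+1 j ++ [:: rev_ord j]) =
    h * W (nseq k.+1 j ++ [:: rev_ord j]) &
  h = push i \/ h = copy_at [:: i] (push (rev_ord i)) ^+ k.+1 * push i ^+ k.+2.
Proof.
rewrite word_cat word_nseq word1; case/orP: (ord2_cases i j) => /eqP ->.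
  by exists (push i); [rewrite exprS !mulrA push_gen | left].
rewrite rev_ordK.
exists (copy_at [:: i] (push (rev_ord i)) ^+ k.+1 * push i ^+ k.+2); last by right.
have strip := push_iter_strip i k (S i).
rewrite 2!(exprS (push i)) -!mulrA strip.
rewrite (mulrA (push i) (S _)) push_rev_gen (mulrA (push i) (S i)) push_gen -mulrA.
have := copy_at_conj_iter [:: i] k.+1 (push (rev_ord i)) (S i * S (rev_ord i)).
rewrite word1 => ->; congr (_ * _).
have := push_rev_gen (rev_ord i); rewrite rev_ordK => h.
by rewrite [in RHS]exprSr -mulrA (mulrA (push _)) h push_iter_grow.
Qed.

End ThompsonElements.

(** * Membership in F and in V *)
Section ThompsonGroups.
Context {R : realType} {A : cstarAlgebra R} (S : 'I_2 -> A).
Context (cuntzS : is_cuntz2 S).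
Implicit Types (x y b v : A) (a : R[i]) (w t d u : seq 'I_2) (z : nat -> 'I_2).

Local Notation W := (cuntz_word S).
Local Notation words := (seq 'I_2).

Lemma thompsonV_nat_span x : thompsonV S x -> nat_span S x.
Proof. by move=> [J [_ ->]]; exists J. Qed.

Lemma word2_cons_le (i j : 'I_2) (s t : word2) :
  (((i :: s) : word2) <= ((j :: t) : word2))%O = (i < j)%N || ((i == j) && (s <= t)%O).
Proof.
by rewrite lexi_cons; case: i => -[|[]] // ?; case: j => -[|[]].
Qed.

(** The order of the first words and the order of the second words agree on three pairs
    as soon as both increase strictly. *)
Lemma thompsonF3 (p q r : word2 * word2) :
  (p.1 < q.1)%O -> (q.1 < r.1)%O -> (p.2 < q.2)%O -> (q.2 < r.2)%O ->
  cstar_unitary (mono S p + (mono S q + mono S r)) ->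
  thompsonF S (mono S p + (mono S q + mono S r)).
Proof.
move=> pq1 qr1 pq2 qr2 unit_sum.
have [pr1 pr2] := (lt_trans pq1 qr1, lt_trans pq2 qr2).
have ne (x y : word2 * word2) : (x.1 < y.1)%O -> x != y.
  by move=> h; apply/eqP => e; rewrite e ltxx in h.
exists (p |` (q |` [fset r]))%fset.
  split=> //; rewrite !big_fsetU1 ?big_seq_fset1 // !inE ?negb_or ?ne //.
have gt (x y : word2) : (x < y)%O -> (y <= x)%O = false by exact: lt_geF.
by move=> x y; rewrite !inE => /or3P[]/eqP-> /or3P[]/eqP-> //;
  rewrite ?(ltW pq2, ltW qr2, ltW pr2, gt _ _ pq1, gt _ _ qr1, gt _ _ pr1).
Qed.

Lemma thompsonF_x : thompsonF S (thompson_x S).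
Proof.
pose p : word2 * word2 := ([:: ord0; ord0], [:: ord0]).
pose q : word2 * word2 := ([:: ord0; ord_max], [:: ord_max; ord0]).
pose r : word2 * word2 := ([:: ord_max], [:: ord_max; ord_max]).
have xE : thompson_x S = mono S p + (mono S q + mono S r).
  by rewrite addrA /mono /= !word_cons !word_nil !mulr1.
by rewrite xE; apply: thompsonF3; rewrite -?xE //; exact: x_unitary.
Qed.

(** Prefixing all the words by i keeps their order, and the extra pair, made of the other
    letter, lies on the same side of all of them in both components. *)
Lemma thompsonF_copy1 i x : thompsonF S x -> thompsonF S (copy_at S [:: i] x).
Proof.
move=> [J [ux xE] mono_J].
pose h (p : word2 * word2) : word2 * word2 := (i :: p.1, i :: p.2).
pose r : word2 * word2 := ([:: rev_ord i], [:: rev_ord i]).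
have h_inj : injective h by move=> [p1 p2] [q1 q2] [-> ->].
have rh : r \notin [fset h p | p in J]%fset.
  by apply/imfsetP => -[p _ [e]]; have := rev_ord2_neq i; rewrite e eqxx.
exists (r |` [fset h p | p in J])%fset.
  split; first exact: copy_at_unitary.
  rewrite big_fsetU1 // big_imfset /=; last by move=> p q _ _ /h_inj.
  rewrite xE !word1 addrC mulr_sumr mulr_suml; congr (_ + _).
  by apply: eq_bigr => p _; rewrite !word_cons starM !mulrA.
move=> p q; rewrite !in_fset1U.
case/predU1P => [->|/imfsetP[p' p'J ->]]; case/predU1P => [->|/imfsetP[q' q'J ->]] //=.
- by rewrite !word2_cons_le eq_sym rev_ord2_neq.
- rewrite !word2_cons_le ltnn eqxx /=; exact: mono_J.
Qed.

Lemma thompsonF_copy u x : thompsonF S x -> thompsonF S (copy_at S u x).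
Proof.
move=> Fx; elim: u => //= i u IH; exact: thompsonF_copy1 i _ IH.
Qed.

Lemma zero_one_thompsonV x : cstar_unitary x -> zero_one S x -> thompsonV S x.
Proof.
move=> ux /(zero_one_sum cuntzS)[s [us xE _]].
exists (seq_fset tt (s : seq (word2 * word2))); split => //.
by rewrite xE (perm_big _ (seq_fset_perm _ _)) /= undup_id.
Qed.

(** The entries of a sum of monomials are natural numbers, and no entry exceeds the
    norm. *)
Lemma nat_span_entry x w w' z : nat_span S x -> nrm x <= 1 -> aperiodic z ->
  exists g : bool, entry S x w w' z g%:R.
Proof.
move=> [s xE] x1 az.
pose s1 : seq (R[i] * (words * words)) := [seq (1, p) | p <- s].
have xE1 : x = lincomb S s1.
  by rewrite xE /lincomb big_map; apply: eq_bigr => p _; rewrite scale1r.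
have [N sN] := lincomb_short s1.
rewrite -(scat_pre N z); set t := pre z N.
have hN : (N <= size (w' ++ t))%N by rewrite size_cat size_pre leq_addl.
have az' := @aperiodic_stail N z az.
have h := corner_lincomb cuntzS (w ++ t) sN hN az'; rewrite -xE1 in h.
pose n := (\sum_(p <- s) mono_coef p (w ++ t) (w' ++ t))%N.
have cE : coef s1 (w ++ t) (w' ++ t) = n%:R.
  by rewrite /coef big_map natr_sum; apply: eq_bigr => p _; rewrite mul1r.
have n1 : (n <= 1)%N.
  case: h => m _ /(_ m (leqnn m)) hm; rewrite -(ler_nat R).
  apply: le_trans x1; apply: le_trans (nrm_corner cuntzS x (w ++ t) (w' ++ t) (stail N z) m).
  by rewrite hm cE nrmZnat nrm1 mulr1.
exists (n == 1%N); apply/entry_scat; apply: entry_exact.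
apply: filterS h => m ->; rewrite cE.
by case: (n) n1 => [|[]].
Qed.

(** * The automorphism *)
Section Automorphism.
Context (u : A) (unitary_u : cstar_unitary u) (lam : {lrmorphism A -> A}).
Context (lam_star : {morph lam : x / star x}).
Context (lamS : forall i, lam (S i) = u * S i).
Context (bij_lam : bijective lam) (lamFV : lam @` thompsonF S `<=` thompsonV S).

Lemma lam_surj y : exists x, lam x = y.
Proof. by case: bij_lam => f _ fK; exists (f y). Qed.

Lemma lam_F x : thompsonF S x -> thompsonV S (lam x).
Proof. by move=> Fx; apply: lamFV; exists x. Qed.

(** Let q be the image of P_d and v that of the copy f of x_0 in the cylinder of d.  If a
    power of v fixes wz, it fixes a whole cylinder; then the same power of f fixes the
    preimage of that cylinder projection, which is therefore orthogonal to P_d, and the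
    row wz of q vanishes.  Otherwise the row wz of 1 - q vanishes. *)
Lemma lam_cylinder_entry d w w' z : aperiodic z ->
  entry S (lam (W d * star (W d))) w w' z 0 \/
  entry S (lam (W d * star (W d))) w w' z (w == w')%:R.
Proof.
move=> az; set q := lam _; set f := copy_at S d (thompson_x S).
have Vv : thompsonV S (lam f) by apply/lam_F/thompsonF_copy/thompsonF_x.
have vv : star (lam f) * lam f = 1 by case: Vv => J [[]].
have [[n [j [n0 fix_w]]]|wand] := pselect (exists n j, (0 < n)%N /\
    lam f ^+ n * W (w ++ pre z j) = W (w ++ pre z j)).
  left; have [b bE] := lam_surj (W (w ++ pre z j)).
  have qW : q * W (w ++ pre z j) = 0.
    rewrite -bE -rmorphM -mulrA (@copy_at_fix_eq0 _ _ _ cuntzS d n) ?mulr0 ?rmorph0 //.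
    by apply: (bij_inj bij_lam); rewrite rmorphM rmorphXn /= bE.
  have Wq : star (W (w ++ pre z j)) * q = 0.
    have q_star : star q = q by rewrite -lam_star starM starK.
    by rewrite -q_star -starM qW star0.
  apply: entry_exact; apply/(near_addl j); near=> m.
  by rewrite /corner pre_cat catA word_cat starM -!mulrA (mulrA _ q) Wq mul0r mulr0 scale0r.
right; have -> : q = 1 - (1 - q) by rewrite opprB addrCA subrr addr0.
rewrite -[_%:R]subr0; apply: entryB.
  apply: entry_exact; apply: filterS (star_word_aperiodic cuntzS w w' az) => m.
  by rewrite /corner mulr1 => ->; case: (_ == _); rewrite ?scale1r ?scale0r.
apply: (entry_wandering cuntzS _ (thompsonV_nat_span Vv) vv) => //.
  by rewrite /q -(rmorph1 lam) -rmorphB -rmorphM /= copy_at_compl.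
by move=> n j n0 e; apply: wand; exists n, j.
Unshelve. all: by end_near. Qed.

Lemma lam_cylinder d : exists K : seq words,
  lam (W d * star (W d)) = \sum_(w <- K) W w * star (W w).
Proof.
set q := lam _; have az := pow2_stream_aperiodic.
have zo : zero_one S q.
  move=> w w'; case: (lam_cylinder_entry d w w' az) => h.
    by exists false, pow2_stream; split.
  by exists (w == w'), pow2_stream; split.
have [s [_ qE diag]] := zero_one_sum cuntzS zo.
exists [seq p.1 | p <- s]; rewrite qE big_map; apply: eq_big_seq => p ps.
have [z az' h1] := diag p ps.
suff e : p.1 = p.2 by rewrite /mono e.
have ne0 : 1 <> 0 :> R[i] by apply/eqP; rewrite oner_eq0.
case: (lam_cylinder_entry d p.1 p.2 az') => h; first by case: ne0; apply: entry_uniq h1 h.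
by have := entry_uniq h1 h; case: eqP => // _ /ne0.
Qed.

Definition run (j : 'I_2) k : words := nseq k.+1 j ++ [:: rev_ord j].

(** S_i P_t = h P_t for t = run j k, with h a product of elements of F. *)
Lemma lam_gen_run i j k : nat_span S (lam (S i * (W (run j k) * star (W (run j k))))).
Proof.
have [h hE hc] := gen_mul_runE cuntzS i j k.
have span_push l : nat_span S (lam (push S l)).
  have span_x := thompsonV_nat_span (lam_F (thompsonF_x)).
  by rewrite /push; case: ifP => _ //; rewrite lam_star; exact: nat_span_star.
have span_copy l : nat_span S (lam (copy_at S [:: l] (push S (rev_ord l)))).
  have span_x := thompsonV_nat_span (lam_F (thompsonF_copy [:: l] thompsonF_x)).
  rewrite /push; case: ifP => _ //; rewrite -(star_copy_at cuntzS) lam_star.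
  exact: nat_span_star.
have span_h : nat_span S (lam h).
  case: hc => ->; first exact: span_push.
  rewrite rmorphM !rmorphXn /=; apply: (nat_spanM cuntzS).
    by apply: (nat_spanX cuntzS); exact: span_copy.
  by apply: (nat_spanX cuntzS); exact: span_push.
rewrite mulrA hE -mulrA rmorphM -/(run j k); apply: (nat_spanM cuntzS) => //.
have [K KE] := lam_cylinder (run j k); rewrite [X in nat_span S X]KE.
by exists [seq (w, w) | w <- K]; rewrite big_map.
Qed.

(** If none of the images of the P_(run j k) contained a subcylinder of the cylinder of w,
    all of them would kill it.  Its preimage b would then be killed by all the P_(run j k)
    themselves, hence have zero entries, since every word extends to one beginning with
    some run. *)
Lemma lam_run_meets w : exists t j k,
  lam (W (run j k) * star (W (run j k))) * W (w ++ t) = W (w ++ t).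
Proof.
apply: contrapT => none.
have zero j k : lam (W (run j k) * star (W (run j k))) * W w = 0.
  set q := lam _; have [K qK] := lam_cylinder (run j k); rewrite -/q in qK.
  have qq : q * q = q.
    by rewrite -rmorphM /= !mulrA -(mulrA (W _)) (star_wordK cuntzS) mulr1.
  pose M := (\sum_(v <- K) size v)%N.
  rewrite -[RHS](mul0r (W w)); apply: (@eq_mul_word_cat _ _ _ cuntzS _ _ _ M) => t tM.
  rewrite mul0r.
  (* At this depth each cylinder of K contains the cylinder of w t or is disjoint from
     it; n counts the former, and n = n^2 as q is idempotent. *)
  have [n qn] : exists n : nat, q * W (w ++ t) = n%:R *: W (w ++ t).
    exists (\sum_(v <- K) (take (size v) (w ++ t) == v))%N.
    rewrite qK mulr_suml natr_sum scaler_suml; apply: eq_big_seq => v vK.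
    have hv : (size v <= size (w ++ t))%N.
      by rewrite size_cat tM /M (big_rem v) //= addnCA leq_addr.
    rewrite -mulrA (star_word_word cuntzS hv); case: eqP => [e|_]; last by rewrite mulr0 scale0r.
    by rewrite scale1r -word_cat -{1}e cat_take_drop.
  have := congr1 ( *%R q) qn; rewrite mulrA qq -scalerAr qn scalerA -natrM => /eqP.
  rewrite -subr_eq0 -scalerBl scaler_eq0 (negPf (word_neq0 cuntzS _)) orbF subr_eq0.
  rewrite eqr_nat; case: n qn => [|[|n]]; first by rewrite scale0r.
    by rewrite scale1r => e; case: none; exists t, j, k.
  by move=> _; rewrite -{1}[n.+2]muln1 eqn_pmul2l.
have [b bE] := lam_surj (W w).
suff b0 : b = 0 by have := word_neq0 cuntzS w; rewrite -bE b0 rmorph0 eqxx.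
apply: (entry0_eq0 cuntzS) => v v'.
have [t [j [k [t' e]]]] := mixed_ext v.
exists (scat t pow2_stream); first exact/aperiodic_scat/pow2_stream_aperiodic.
apply/entry_scat; apply: entry_exact; near=> m.
have run_b : star (W (run j k)) * b = 0.
  rewrite -[LHS]mul1r -(star_wordK cuntzS (run j k)) -mulrA (mulrA (W _)).
  suff -> : W (run j k) * star (W (run j k)) * b = 0 by rewrite mulr0.
  by apply: (bij_inj bij_lam); rewrite rmorphM [X in _ * X]bE rmorph0; exact: zero.
have vtE : v ++ t = run j k ++ t' by rewrite e /run -catA.
rewrite /corner vtE -(catA _ t') (word_cat S (run j k)) starM.
by rewrite -(mulrA _ _ b) run_b mulr0 mul0r scale0r.
Unshelve. all: by end_near. Qed.

(** Below every cylinder there is one on which u agrees, up to the first letter i, with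
    lambda(S_i P) for a P with lambda(P) = 1 there. *)
Lemma zero_one_u : zero_one S u.
Proof.
move=> w w'; pose i : 'I_2 := head ord0 (w' ++ [:: ord0]).
pose d := behead (w' ++ [:: ord0]).
have w'E : w' ++ [:: ord0] = i :: d by rewrite /i /d; case: (w').
have [t [j [k q_fix]]] := lam_run_meets d.
have az := pow2_stream_aperiodic.
pose x := u * W ((i :: d) ++ t).
have xE : x = lam (S i * (W (run j k) * star (W (run j k)))) * W (d ++ t).
  by rewrite rmorphM /= lamS -mulrA q_fix /x cat_cons word_cons mulrA.
have x_span : nat_span S x.
  by rewrite xE; apply: (nat_spanM cuntzS) => //; [exact: lam_gen_run | exact: nat_span_word].
have x1 : nrm x <= 1.
  apply: nrm_le1M; last by rewrite (nrm_word cuntzS).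
  by rewrite nrm_isometry //; case: unitary_u.
have [g hg] := nat_span_entry (w ++ [:: ord0] ++ t) [::] x_span x1 az.
exists g, (scat ([:: ord0] ++ t) pow2_stream); split; first exact: aperiodic_scat.
apply/entry_scat => e e0; apply: filterS (hg e e0) => m.
suff -> : corner S x (w ++ [:: ord0] ++ t) [::] pow2_stream m =
    corner S u (w ++ [:: ord0] ++ t) (w' ++ [:: ord0] ++ t) pow2_stream m by [].
by rewrite /corner (catA w') w'E (word_cat S (_ ++ t)) /x !mulrA.
Qed.

Lemma u_thompsonV : thompsonV S u.
Proof. exact: zero_one_thompsonV unitary_u zero_one_u. Qed.

End Automorphism.
End ThompsonGroups.

Theorem theorem3p12 (R : realType) (O2 : cstarAlgebra R) (S : 'I_2 -> O2)
    (cuntzS : is_cuntz2 S) (u : O2) (unitary_u : cstar_unitary u)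
    (lambda_u : {lrmorphism O2 -> O2})
    (lambda_u_star : {morph lambda_u : x / star x})
    (lambda_uS : forall i, lambda_u (S i) = u * S i) :
  bijective lambda_u ->
  lambda_u @` thompsonF S `<=` thompsonV S ->
  thompsonV S u.
Proof.
move=> bij_lam lamFV; exact: (u_thompsonV cuntzS unitary_u lambda_u_star lambda_uS).
Qed.
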